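(* Let $r\in(0,1)$ and let $m\ge 2$ be an integer. If $\{K_i\}_{i=1}^{p}$ are dust-like graph-directed sets with ratio $r$ and integer characteristic $m$, then each of $K_1,\dots,K_p$ is bilipschitz equivalent to $\Sigma_m^r$.
   Context: Graph-directed sets: let $G$ be a finite directed graph (multiple edges and loops allowed) with vertices $\{1,\dots,p\}$; let $\mathcal{E}_{i,j}$ be the set of edges from $i$ to $j$, and $A=(a_{i,j})_{1\le i,j\le p}$ with $a_{i,j}=\#\mathcal{E}_{i,j}$ the adjacency matrix. Every vertex has at least one outgoing edge. Let $(X,\mathrm{d})$ be a (nonempty) compact metric space and, for each edge $e$, let $S_e:X\to X$ satisfy $\mathrm{d}(S_ex,S_ey)=r\,\mathrm{d}(x,y)$ for all $x,y\in X$. There is a unique family $\{K_1,\dots,K_p\}$ of nonempty compact subsets of $X$ with $K_i=\bigcup_{j}\bigcup_{e\in\mathcal{E}_{i,j}}S_e(K_j)$ for every $i$; these are the graph-directed sets with ratio $r$. They are dust-like if for every $i$ this union is a disjoint union. They have integer characteristic $m$ (an integer $m\ge2$) if there is a vector $v\in\mathbb{R}^p$ with all entries positive and $Av=mv$. Symbolic space: $\Sigma_m^r=\{1,\dots,m\}^{\infty}$ (infinite sequences $x_0x_1x_2\cdots$) with metric $d(x_0x_1\cdots,y_0y_1\cdots)=r^{\min\{k:\,x_k\ne y_k\}}$ for distinct sequences. Two metric spaces $(B,\mathrm{d}_B)$, $(B',\mathrm{d}_{B'})$ are bilipschitz equivalent if there are a bijection $f:B\to B'$ and a constant $C>0$ with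 $C^{-1}\mathrm{d}_B(x,y)\le \mathrm{d}_{B'}(f(x),f(y))\le C\,\mathrm{d}_B(x,y)$ for all $x,y\in B$. *)

(* Defs.v *)
From HB Require Import structures.
From mathcomp Require Import all_boot all_order all_algebra.
From mathcomp Require Import all_classical all_reals all_analysis.

Set Implicit Arguments.
Unset Strict Implicit.
Unset Printing Implicit Defensive.

Import Order.TTheory GRing.Theory Num.Theory.

Local Open Scope classical_set_scope.
Local Open Scope ring_scope.

(* Edges form an arbitrary finite type, so loops and multiple edges occur. *)
Record digraph (p : nat) := Digraph {
  edge : finType;
  src : edge -> 'I_p;
  tgt : edge -> 'I_p
}.

Definition edges p (G : digraph p) (i j : 'I_p) : {set edge G} :=
  [set e | (src e == i) && (tgt e == j)]%SET.

Definition adjacency (R : realType) p (G : digraph p) : 'M[R]_p :=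
  \matrix_(i, j) #|edges G i j|%:R.

Definition similarity (R : realType) (X : metricType R) (r : R) (f : X -> X) :=
  forall x y : X, mdist (f x) (f y) = r * mdist x y.

Definition graph_directed_sets (R : realType) (X : metricType R) (r : R) p
    (G : digraph p) (S : edge G -> X -> X) (K : 'I_p -> set X) : Prop :=
  [/\ forall i, exists e : edge G, src e = i,
      forall e, similarity r (S e),
      forall i, K i !=set0 /\ compact (K i) &
      forall i, K i = \bigcup_j \bigcup_(e in [set` edges G i j]) (S e @` K j)].

(* The pieces are indexed by edges, not compared as sets: two distinct edges
   out of i must have disjoint pieces, even when they are parallel. *)
Definition dust_like (R : realType) (X : metricType R) p
    (G : digraph p) (S : edge G -> X -> X) (K : 'I_p -> set X) : Prop :=
  forall i, trivIset [set e | src e = i] (fun e => S e @` K (tgt e)).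

Definition integer_characteristic (R : realType) p (G : digraph p) (m : nat) :
    Prop :=
  (2 <= m)%N /\
  exists v : 'cV[R]_p,
    (forall i, 0 < v i 0) /\ adjacency R G *m v = m%:R *: v.

(* The proof that r lies in (0,1) is a parameter of the type because it is
   needed for the metric structure; letters 1, ..., m are coded by 'I_m. *)
Definition symbolic (R : realType) (r : R) (hr : 0 < r < 1) (m : nat) : Type :=
  nat -> 'I_m.

Section symbolic_metric.
Context (R : realType) (r : R) (hr : 0 < r < 1) (m : nat).
Implicit Types x y z : symbolic hr m.

Definition symbolic_dist x y : R :=
  if pselect (exists k, x k != y k) is left h then r ^+ ex_minn h else 0.

Let distxx x : symbolic_dist x x = 0.
Proof.
rewrite /symbolic_dist; case: pselect => // h.
by have [k] := h; rewrite eqxx.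
Qed.

Let dist_positivity x y : symbolic_dist x y = 0 -> x = y.
Proof.
have /andP[r0 _] := hr.
rewrite /symbolic_dist; case: pselect => [h /eqP|h _].
  by rewrite expf_eq0 (gt_eqF r0) andbF.
by apply/funext => k; apply/eqP/negPn/negP => xy; apply: h; exists k.
Qed.

Let dist_sym x y : symbolic_dist x y = symbolic_dist y x.
Proof.
rewrite /symbolic_dist; case: pselect => [h|h]; case: pselect => [h'|h'] //.
- congr (_ ^+ _); case: ex_minnP => k xyk mk; case: ex_minnP => l xyl ml.
  by apply/eqP; rewrite eqn_leq mk 1?eq_sym// ml// eq_sym.
- by case: h' => //; case: h => k; exists k; rewrite eq_sym.
- by case: h => //; case: h' => k; exists k; rewrite eq_sym.
Qed.

Let dist_ge0 x y : 0 <= symbolic_dist x y.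
Proof.
have /andP[r0 _] := hr.
by rewrite /symbolic_dist; case: pselect => // h; exact/exprn_ge0/ltW.
Qed.

Let dist_triangle y x z :
  symbolic_dist x z <= symbolic_dist x y + symbolic_dist y z.
Proof.
rewrite {1}/symbolic_dist; case: pselect => [h|_]; last by rewrite addr_ge0.
have /andP[r0 r1] := hr.
case: ex_minnP => n xzn _.
have far u v : u n != v n -> r ^+ n <= symbolic_dist u v.
  move=> uvn; rewrite /symbolic_dist; case: pselect => [h'|[]]; last by exists n.
  by case: ex_minnP => k _ /(_ _ uvn) kn; rewrite ler_wiXn2l// ltW.
have [xyn|xyn] := eqVneq (x n) (y n).
  by rewrite (le_trans (far y z _)) ?lerDr// -xyn.
by rewrite (le_trans (far x y xyn))// lerDl.
Qed.

HB.instance Definition _ := gen_eqMixin (symbolic hr m).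
HB.instance Definition _ := gen_choiceMixin (symbolic hr m).
HB.instance Definition _ := @isMetric.Build R (symbolic hr m)
  symbolic_dist distxx dist_positivity dist_sym dist_triangle.

End symbolic_metric.

(* Metric spaces are given as subsets of metric types, with the induced
   metric; only the values of f on A matter. *)
Definition bilipschitz_equivalent (R : realType) (X Y : metricType R)
    (A : set X) (B : set Y) : Prop :=
  exists f : X -> Y, set_bij A B f /\
  exists2 C : R, 0 < C & forall x y, A x -> A y ->
    C^-1 * mdist x y <= mdist (f x) (f y) <= C * mdist x y.

(* Main.v *)
(* Iterating the system so that the relation "some edge goes from i to j" becomes
   idempotent, call j terminal if j reaches itself and all its successors reach
   each other. The eigenvector may be taken integral; v_j is then the mass of the
   pieces of type j, and the pieces of K_i obtained in k steps have total mass
   m^k v_i. For i terminal, these pieces can for large k be grouped into blocks of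
   one fixed mass M = d m^l, with d generating the masses modulo L = prod v; each
   block has exactly m^k sub-blocks, so that it is coded by the m-ary tree.
   A nonterminal K_i has, for large k, fewer than m^k nonterminal pieces; these
   are assigned distinct cylinders of the symbolic space, recursively, and the
   union of the terminal pieces is mapped onto the union of the other cylinders.
   This is possible because a finite disjoint union of sets equivalent to the
   symbolic space is again equivalent to it, by Hilbert's hotel. Finitely many
   steps of either recursion give correspondences that are bilipschitz up to an
   arbitrarily small additive error; these converge along an ultrafilter. *)

Require Import Defs.
From mathcomp Require Import all_boot all_order all_algebra.
From mathcomp Require Import all_classical all_reals all_analysis.
From mathcomp Require Import zify ring lra.

Set Implicit Arguments.
Unset Strict Implicit.
Unset Printing Implicit Defensive.

Import Order.TTheory GRing.Theory Num.Theory.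
Import numFieldTopology.Exports numFieldNormedType.Exports.

Local Open Scope classical_set_scope.
Local Open Scope ring_scope.

(** * Approximate bilipschitz correspondences and their limits *)

Section correspondences.
Context {R : realType}.
Implicit Types X Y Z : metricType R.

Local Notation dist x y := (mdist x y : R).

(* [metric_sym] and [metric_triangle] reach [mdist] through another coercion
   path, which hides distances from [lra]. *)
Lemma dist_sym X (x y : X) : dist x y = dist y x.
Proof. exact: metric_sym. Qed.

Lemma dist_triangle X (x y z : X) : dist x z <= dist x y + dist y z.
Proof. exact: metric_triangle. Qed.

(* A bijection is encoded as a relation that is total on both sides; with
   [e = 0] the distance bounds force it to be the graph of a bilipschitz
   bijection, while [e > 0] only controls it at scales above [e]. *)
Definition acorr X Y (C e : R) (A : set X) (B : set Y) (rho : X -> Y -> Prop) :=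
  [/\ forall x y, rho x y -> A x /\ B y,
      forall x, A x -> exists y, rho x y,
      forall y, B y -> exists x, rho x y &
      forall x y x' y', rho x y -> rho x' y' ->
        dist y y' <= C * dist x x' + e /\ dist x x' <= C * dist y y' + e].

Definition bilip X Y (A : set X) (B : set Y) :=
  exists C rho, 0 < C /\ acorr C 0 A B rho.

Lemma acorr_weak X Y (C C' e e' : R) (A : set X) (B : set Y) rho :
  C <= C' -> e <= e' -> acorr C e A B rho -> acorr C' e' A B rho.
Proof.
move=> CC ee [AB tA tB d]; split=> // x y x' y' r1 r2.
have [h1 h2] := d _ _ _ _ r1 r2; have := mdist_ge0 x x'.
have := mdist_ge0 y y'; split; nra.
Qed.

Lemma bilip_sym X Y (A : set X) (B : set Y) : bilip A B -> bilip B A.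
Proof.
move=> [C [rho [C0 [AB tA tB d]]]]; exists C, (fun y x => rho x y); split=> //.
split=> // [y x /AB[]//|y x y' x' r1 r2].
by have [] := d _ _ _ _ r1 r2.
Qed.

Lemma bilip_trans X Y Z (A : set X) (B : set Y) (D : set Z) :
  bilip A B -> bilip B D -> bilip A D.
Proof.
move=> [C [rho [C0 [AB tA tB d]]]] [C' [rho' [C'0 [AB' tA' tB' d']]]].
exists (C * C'), (fun x z => exists2 y, rho x y & rho' y z).
split; first exact: mulr_gt0.
split=> [x z [y /AB[Ax _] /AB'[_ Dz]]//|x /tA[y r]|z /tB'[y r]|].
- by have [_ /tA'[z r']] := AB _ _ r; exists z, y.
- by have [/tB[x r'] _] := AB' _ _ r; exists x, y.
move=> x z x' z' [y r1 r2] [y' r1' r2'].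
have := d _ _ _ _ r1 r1'; have := d' _ _ _ _ r2 r2'.
by rewrite !addr0 => -[? ?] [? ?]; split; nra.
Qed.

Lemma bilip_scale X Y (a : R) (A : set X) (phi : X -> Y) : 0 < a ->
  (forall x y, dist (phi x) (phi y) = a * dist x y) -> bilip A (phi @` A).
Proof.
move=> a0 sim; exists (a + a^-1), (fun x y => A x /\ y = phi x).
have ai0 : 0 < a^-1 by rewrite invr_gt0.
split; first by rewrite addr_gt0.
split=> [x y [Ax ->]|x Ax|y [x Ax <-]|x _ x' _ [Ax ->] [Ax' ->]].
- by split=> //; exists x.
- by exists (phi x).
- by exists x.
rewrite !addr0 sim; have xx := mdist_ge0 x x'.
have aa : a^-1 * a = 1 by rewrite mulVf// gt_eqF.
by split; nra.
Qed.

(** Scaling both sides by the same factor leaves [C] unchanged and affects only the additive error;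
    for [a < 1] this makes recursive constructions converge. *)
Lemma acorr_scale X X' Y Y' (C e a : R) (A : set X) (B : set Y) rho
    (phi : X -> X') (psi : Y -> Y') : 0 < a ->
  (forall x y, dist (phi x) (phi y) = a * dist x y) ->
  (forall x y, dist (psi x) (psi y) = a * dist x y) ->
  acorr C e A B rho ->
  acorr C (a * e) (phi @` A) (psi @` B)
    (fun x y => exists u v, [/\ rho u v, x = phi u & y = psi v]).
Proof.
move=> a0 sphi spsi [AB tA tB d].
split=> [_ _ [u [v [/AB[Au Bv] -> ->]]]|_ [u Au <-]|_ [v Bv <-]|].
- by split; [exists u|exists v].
- by have [v r] := tA _ Au; exists (psi v), u, v.
- by have [u r] := tB _ Bv; exists (phi u), u, v.
move=> _ _ _ _ [u [v [r1 -> ->]]] [u' [v' [r2 -> ->]]].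
have [] := d _ _ _ _ r1 r2; rewrite sphi spsi !(mulrCA C) -!mulrDr.
by rewrite !ler_pM2l.
Qed.

Definition separated X (J : Type) (delta : R) (P : set J) (A : J -> set X) :=
  forall j j', P j -> P j' -> j <> j' ->
  forall x x', A j x -> A j' x' -> delta <= dist x x'.

Definition diam_le X (D : R) (A : set X) :=
  forall x x', A x -> A x' -> dist x x' <= D.

(** Two points of one piece are handled by its own correspondence. For points of different pieces
    both distances lie between [delta] and [D], so [D <= C * delta] suffices and the constant does
    not grow. *)
Lemma acorr_bigcup X Y (J : Type) (P : set J) (A : J -> set X) (B : J -> set Y)
    rho (C e delta D : R) :
  (forall j, P j -> acorr C e (A j) (B j) (rho j)) ->
  separated delta P A -> separated delta P B ->
  diam_le D (\bigcup_(j in P) A j) -> diam_le D (\bigcup_(j in P) B j) ->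
  0 <= C -> 0 <= e -> D <= C * delta ->
  acorr C e (\bigcup_(j in P) A j) (\bigcup_(j in P) B j)
    (fun x y => exists2 j, P j & rho j x y).
Proof.
move=> cA sA sB dA dB C0 e0 DC.
split=> [x y [j Pj r]|x [j Pj Ajx]|y [j Pj Bjy]|].
- by have [/(_ _ _ r)[? ?] _ _ _] := cA _ Pj; split; exists j.
- by have [_ /(_ _ Ajx)[y r] _ _] := cA _ Pj; exists y, j.
- by have [_ _ /(_ _ Bjy)[x r] _] := cA _ Pj; exists x, j.
move=> x y x' y' [j Pj r] [j' Pj' r'].
have [jj'|jj'] := pselect (j = j').
  by subst j'; have [_ _ _] := cA _ Pj; exact.
have [/(_ _ _ r)[Ax By] _ _ _] := cA _ Pj.
have [/(_ _ _ r')[Ax' By'] _ _ _] := cA _ Pj'.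
have h1 := sA _ _ Pj Pj' jj' _ _ Ax Ax'.
have h2 := sB _ _ Pj Pj' jj' _ _ By By'.
have h3 : dist x x' <= D by apply: dA; [exists j|exists j'].
have h4 : dist y y' <= D by apply: dB; [exists j|exists j'].
by split; nra.
Qed.

(** An ultrafilter makes every sequence in a compact set converge, so one choice of [U] serves all
    points at once and no subsequence is extracted. *)
Lemma ultra_lim X (U : set_system nat) (A : set X) (f : nat -> X) :
  UltraFilter U -> compact A -> (forall n, A (f n)) ->
  exists2 p, A p & forall e, 0 < e -> U [set n | dist p (f n) < e].
Proof.
move=> UU cA Af; have FA : (f @ U) A.
  by apply: (@filterS _ U _ setT) => [n _|]; [exact: Af|exact: filterT].
have [p [Ap clp]] := cA (f @ U) (fmap_proper_filter _ _) FA.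
exists p => // e e0.
have [//|h] := in_ultra_setVsetC [set n | dist p (f n) < e] UU.
have nb : nbhs p (ball p e) by exact: nbhsx_ballx.
have [||x [xC]] := clp (~` ball p e) (ball p e) => //.
by rewrite /fmap/=; apply: filterS h => n; rewrite ballEmdist.
Qed.

Lemma ultra_oo : exists (U : set_system nat) (u : nat -> R),
  [/\ UltraFilter U, forall n, 0 < u n &
      forall e : R, 0 < e -> U [set n | u n < e]].
Proof.
have [U [UU sU]] := ultraFilterLemma eventually_filter.
exists U, (fun n => n.+1%:R^-1); split=> // e e0; apply: sU.
exact: (near_infty_natSinv_lt (PosNum e0)).
Qed.

(** Points are related in the limit if, for [U]-almost all [n], some pair of [rho n] is close to
    them. Compactness of the opposite side makes this relation total. *)
Lemma acorr_limit X Y (A : set X) (B : set Y) (C : R) : 0 < C ->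
  compact A -> compact B ->
  (forall e, 0 < e -> exists rho, acorr C e A B rho) -> bilip A B.
Proof.
move=> C0 cA cB H.
have [U [u_ [UU u0 Usmall]]] := ultra_oo.
have UF : Filter U by exact: _.
have /choice[rho Hrho] : forall n : nat, exists rho, acorr C (u_ n) A B rho.
  by move=> n; exact: H.
pose near e (x : X) (y : Y) : set nat :=
  [set n | exists u v, [/\ rho n u v, dist x u < e & dist y v < e]].
exists C, (fun x y => [/\ A x, B y & forall e, 0 < e -> U (near e x y)]).
split=> //; split=> [x y []//|x Ax|y By|x y x' y' [Ax By r] [Ax' By' r']].
- have /choice[f Hf] : forall n, exists y, rho n x y.
    by move=> n; have [_ /(_ _ Ax)] := Hrho n.
  have Bf n : B (f n) by have [/(_ _ _ (Hf n))[]] := Hrho n.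
  have [y By Hy] := ultra_lim UU cB Bf.
  exists y; split=> // e e0; apply: filterS (Hy _ e0) => n yn.
  by exists x, (f n); split=> //; rewrite mdistxx.
- have /choice[f Hf] : forall n, exists x, rho n x y.
    by move=> n; have [_ _ /(_ _ By)] := Hrho n.
  have Af n : A (f n) by have [/(_ _ _ (Hf n))[]] := Hrho n.
  have [x Ax Hx] := ultra_lim UU cA Af.
  exists x; split=> // e e0; apply: filterS (Hx _ e0) => n yn.
  by exists (f n), y; split=> //; rewrite mdistxx.
(* Replacing the four points by [e]-close ones costs [2 * e] on one side and [2 * C * e] on the
   other; the error [u_ n < e] adds one more [e]. *)
have key (e : R) : 0 < e -> dist y y' <= C * dist x x' + (2 * C + 3) * e /\
   dist x x' <= C * dist y y' + (2 * C + 3) * e.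
  move=> e0.
  have /filter_ex[n [[[u [v [r1 xu yv]]] [u' [v' [r2 xu' yv']]]] /= ne]] :=
    @filterI _ U UF _ _ (@filterI _ U UF _ _ (r _ e0) (r' _ e0)) (Usmall _ e0).
  have [_ _ _ /(_ _ _ _ _ r1 r2)[]] := Hrho n.
  have := dist_triangle y v y'; have := dist_triangle v v' y'.
  have := dist_triangle x u x'; have := dist_triangle u u' x'.
  have := dist_triangle v y v'; have := dist_triangle y y' v'.
  have := dist_triangle u x u'; have := dist_triangle x x' u'.
  rewrite (dist_sym u' x') (dist_sym v' y') (dist_sym u x) (dist_sym v y).
  move=> t1 t2 t3 t4 t5 t6 t7 t8 i1 i2.
  have : C * dist u u' <= C * (dist x x' + 2 * e) by rewrite ler_pM2l//; lra.
  have : C * dist v v' <= C * (dist y y' + 2 * e) by rewrite ler_pM2l//; lra.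
  by move=> j1 j2; split; lra.
have C3 : 0 < 2 * C + 3 by nra.
split; apply/ler_addgt0Pr => e e0; rewrite addr0.
  have [+ _] := key (e / (2 * C + 3)) (divr_gt0 e0 C3).
  by rewrite mulrCA divff ?mulr1// gt_eqF.
have [_] := key (e / (2 * C + 3)) (divr_gt0 e0 C3).
by rewrite mulrCA divff ?mulr1// gt_eqF.
Qed.

(** Otherwise points of [A] and [B] come arbitrarily close, and their limits along the ultrafilter
    are a common point. *)
Lemma separated_compact X (A B : set X) : compact A -> compact B ->
  A `&` B = set0 ->
  exists2 d : R, 0 < d & forall x y, A x -> B y -> d <= dist x y.
Proof.
move=> cA cB AB; apply: contrapT => H.
have [U [u_ [UU u0 Usmall]]] := ultra_oo.
have UF : Filter U by exact: _.
have /choice[f Hf] : forall n : nat, exists xy : X * X,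
    [/\ A xy.1, B xy.2 & dist (xy.1) (xy.2) < u_ n].
  move=> n; apply: contrapT => h; apply: H; exists (u_ n) => //.
  move=> x y Ax By; rewrite leNgt; apply/negP => xy; apply: h.
  by exists (x, y).
have [x Ax Hx] : exists2 x, A x & forall e, 0 < e -> U [set n | dist x (f n).1 < e].
  by apply: ultra_lim => // n; have [] := Hf n.
have [y By Hy] : exists2 x, B x & forall e, 0 < e -> U [set n | dist x (f n).2 < e].
  by apply: ultra_lim => // n; have [] := Hf n.
suff xy : x = y by have : (A `&` B) x by [split=> //; rewrite xy]; rewrite AB.
apply: mdist_positivity; apply/eqP; rewrite eq_le mdist_ge0 andbT.
apply/ler_addgt0Pl => e e0; rewrite addr0.
have e3 : 0 < e / 3 by lra.
have /filter_ex[n [[/= h1 h2] h3]] :=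
  @filterI _ U UF _ _ (@filterI _ U UF _ _ (Hx _ e3) (Hy _ e3)) (Usmall _ e3).
have [_ _ h4] := Hf n.
have := dist_triangle x (f n).1 y; have := dist_triangle (f n).1 (f n).2 y.
by rewrite (dist_sym (f n).2 y) => ? ?; lra.
Qed.

End correspondences.

(** * Cylinders, compactness and recursive coding in the symbolic space *)

Lemma expr_small (R : realType) (q e : R) : 0 < q -> q < 1 -> 0 < e ->
  exists N, q ^+ N < e.
Proof.
move=> q0 q1 e0.
have /cvgrPdist_lt/(_ _ e0)[N _ /(_ N (leqnn N))] : (q ^+ n @[n --> \oo] --> (0 : R)).
  by apply: cvg_expr; rewrite gtr0_norm.
by rewrite /= sub0r normrN gtr0_norm ?exprn_gt0// => Ne; exists N.
Qed.

Section symbolic_space.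
Context {R : realType} {r : R} {hr : 0 < r < 1} {m : nat}.
Local Notation Sigma := (symbolic hr m).
Local Notation W K := {ffun 'I_K -> 'I_m}.
Local Notation dist x y := (mdist x y : R).

Let r0 : 0 < r. Proof. by case/andP: hr. Qed.
Let r1 : r < 1. Proof. by case/andP: hr. Qed.

Lemma sdist_le1 (x y : Sigma) : dist x y <= 1.
Proof.
rewrite /mdist/= /symbolic_dist; case: pselect => // h.
by rewrite exprn_ile1// ltW.
Qed.

Lemma sdist_differ n (x y : Sigma) : x n <> y n -> r ^+ n <= dist x y.
Proof.
move=> /eqP xy; rewrite /mdist/= /symbolic_dist; case: pselect => [h|[]]; last by exists n.
by case: ex_minnP => k _ /(_ _ xy) kn; rewrite ler_wiXn2l// ltW.
Qed.

Lemma sdist_agree n (x y : Sigma) : (forall k, (k < n)%N -> x k = y k) ->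
  dist x y <= r ^+ n.
Proof.
move=> xy; rewrite /mdist/= /symbolic_dist; case: pselect => [h|_].
  case: ex_minnP => k xyk _; rewrite ler_wiXn2l ?ltW// leqNgt.
  by apply/negP => /xy/eqP; exact/negP.
by rewrite exprn_ge0// ltW.
Qed.

Definition catw K (a : W K) (y : Sigma) : Sigma :=
  fun n => if insub n is Some i then a i else y (n - K)%N.

Definition prefix K (y : Sigma) : W K := [ffun i => y (nat_of_ord i)].

Lemma catw_lt K (a : W K) y (i : 'I_K) : catw a y i = a i.
Proof. by rewrite /catw valK. Qed.

Lemma catw_ge K (a : W K) y n : catw a y (n + K) = y n.
Proof. by rewrite /catw insubN -?leqNgt ?leq_addl// addnK. Qed.

Lemma prefix_catw K (a : W K) y : prefix K (catw a y) = a.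
Proof. by apply/ffunP => i; rewrite ffunE catw_lt. Qed.

Lemma catw_prefix K (y : Sigma) : exists z, y = catw (prefix K y) z.
Proof.
exists (fun n => y (n + K)%N); apply/funext => n; have [nK|Kn] := ltnP n K.
  by rewrite (catw_lt _ _ (Ordinal nK)) ffunE.
by rewrite -(subnK Kn) catw_ge.
Qed.

Lemma image_catw K (a : W K) : catw a @` setT = [set y | prefix K y = a].
Proof.
apply/seteqP; split=> [_ [y _ <-]|y <-] /=; first exact: prefix_catw.
by have [z {2}->] := catw_prefix K y; exists z.
Qed.

Lemma sdist_prefix K (x y : Sigma) : prefix K x <> prefix K y ->
  r ^+ K <= dist x y.
Proof.
move=> xy; have [i xyi] : exists i : 'I_K, x i <> y i.
  apply: contrapT => h; apply: xy; apply/ffunP => i; rewrite !ffunE.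
  by apply: contrapT => xyi; apply: h; exists i.
apply: le_trans (sdist_differ xyi).
by rewrite ler_wiXn2l ?(ltW r0) ?(ltW r1)// ltnW.
Qed.

Lemma sdist_catw K (a : W K) x y : dist (catw a x) (catw a y) = r ^+ K * dist x y.
Proof.
have [->|/eqP xy] := eqVneq x y; first by rewrite !mdistxx mulr0.
have [n nxy nmin] : exists2 n, x n != y n & forall k, x k != y k -> (n <= k)%N.
  have h : exists n, x n != y n.
    apply: contrapT => h; apply: xy; apply/funext => n; apply/eqP/negPn/negP.
    by move=> xyn; apply: h; exists n.
  by exists (ex_minn h); case: ex_minnP.
have -> : dist x y = r ^+ n.
  apply/eqP; rewrite eq_le; apply/andP; split; last exact/sdist_differ/eqP.
  apply: sdist_agree => k kn; apply/eqP; apply: contraTT kn => /nmin.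
  by rewrite -leqNgt.
rewrite -exprD addnC; apply/eqP; rewrite eq_le; apply/andP; split; last first.
  by apply: sdist_differ; rewrite !catw_ge; exact/eqP.
apply: sdist_agree => k kn; have [kK|Kk] := ltnP k K.
  by rewrite !(catw_lt _ _ (Ordinal kK)).
rewrite -(subnK Kk) !catw_ge; apply/eqP/negPn/negP => /nmin; lia.
Qed.

(** There are finitely many letters, so along an ultrafilter each coordinate is constant on a large
    set; these constants form the limit. *)
Lemma compact_prefix K (Q : W K -> Prop) :
  compact [set y : Sigma | Q (prefix K y)].
Proof.
rewrite compact_ultra => U UU UA; have UF : Filter U by exact: _.
have /choice[y Hy] : forall k, exists a, U [set x : Sigma | x k = a].
  move=> k; apply: contrapT => h.
  have : U set0; last exact: filter_not_empty.
  have : U [set x | forall a, x k <> a].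
    apply: (@filter_forall _ _ (fun a (x : Sigma) => x k <> a)) => a.
    have [Ua|//] := in_ultra_setVsetC [set x : Sigma | x k = a] UU.
    by exfalso; apply: h; exists a.
  by apply: filterS => x /(_ (x k)).
have Hn n : U [set x | forall k, (k < n)%N -> x k = y k].
  elim: n => [|n IH]; first by apply: filterS filterT => x _ k.
  apply: filterS (@filterI _ U UF _ _ IH (Hy n)) => x [/= xk xn] k.
  by rewrite ltnS leq_eqVlt => /orP[/eqP->//|]; exact: xk.
exists (y : Sigma); split.
  have /filter_ex[x [/= Qx xy]] := @filterI _ U UF _ _ UA (Hn K).
  rewrite (_ : prefix K y = prefix K x)//.
  by apply/ffunP => i; rewrite !ffunE xy.
apply/metricType_numDomainType.fcvgrPdist_lt => e e0.
have [n ne] := expr_small r0 r1 e0.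
apply: filterS (Hn n) => x xy; apply: le_lt_trans ne.
by apply: sdist_agree => k /xy.
Qed.

Lemma compact_sigma : compact [set: Sigma].
Proof.
have := @compact_prefix 0 (fun _ => True).
by rewrite (_ : [set y | True] = setT).
Qed.

Section recursive_pieces.
Context (X : metricType R) (T : Type) (I : finType) (K : nat).
Variables (P : set T) (A U : T -> set X) (Ch : T -> {set I}).
Variables (phi : I -> X -> X) (sg : I -> T) (code : T -> I -> W K).

(** The index [None] stands for the remainder, so that one family covers it together with the coded
    copies. *)
Definition pieces t : set (option I) :=
  [set o | if o is Some i then i \in Ch t else True].
Definition piece t (o : option I) : set X :=
  if o is Some i then phi i @` A (sg i) else U t.
Definition free t : set Sigma := [set y | forall i, i \in Ch t -> code t i <> prefix K y].

(* The set [A t] is made of copies, scaled by [r ^ K], of sets of the same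
   family, together with a remainder [U t] matching the cylinders of length [K]
   that are not used as codes. *)
Lemma bilip_recursive (D delta CU : R) : (0 < K)%N -> 0 < delta ->
  (forall t, P t -> compact (A t) /\ A t !=set0) ->
  (forall t i, P t -> i \in Ch t -> P (sg i)) ->
  (forall i x y, mdist (phi i x) (phi i y) = r ^+ K * mdist x y) ->
  (forall t, P t -> A t = \bigcup_(o in pieces t) piece t o) ->
  (forall t, P t -> separated delta (pieces t) (piece t)) ->
  (forall t, P t -> diam_le D (A t)) ->
  (forall t, P t -> {in Ch t &, injective (code t)}) ->
  (forall t, P t -> exists rho, acorr CU 0 (U t) (free t) rho) ->
  forall t, P t -> bilip (A t) [set: Sigma].
Proof.
move=> K0 delta0 cA Psg sim decA sepA diamA injc corrU.
pose delta' := Num.min delta (r ^+ K); pose D' := Num.max D 1.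
have rK0 : 0 < r ^+ K by exact: exprn_gt0.
have d'0 : 0 < delta' by rewrite lt_min delta0.
have D'1 : 1 <= D' by rewrite le_max lexx orbT.
have DD' : D <= D' by rewrite le_max lexx.
have D'0 : 0 < D' by exact: lt_le_trans D'1.
(* The three terms absorb the remainder, pairs of points in different pieces, and the relation of
   level 0, whose error is at most [D']. *)
pose C := `|CU| + D' / delta' + D'.
have C0 : 0 < C by rewrite ltr_wpDl// addr_ge0// divr_ge0// ltW.
have CD : D' <= C by rewrite lerDr addr_ge0// divr_ge0// ltW.
have CCU : CU <= C.
  by rewrite (le_trans (ler_norm _))// /C -addrA lerDl addr_ge0 ?divr_ge0 ?ltW.
have Cdelta : D' <= C * delta'.
  rewrite /C !mulrDl divfK ?gt_eqF//.
  have := mulr_ge0 (normr_ge0 CU) (ltW d'0).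
  by have := mulr_ge0 (ltW D'0) (ltW d'0); lra.
have err_ge0 n : 0 <= C * (r ^+ K) ^+ n by apply: mulr_ge0; [|apply: exprn_ge0]; exact: ltW.
(* Following the recursion through [N] levels leaves an error proportional to the scale of the
   pieces of that level. *)
suff app N : forall t, P t -> exists rho, acorr C (C * (r ^+ K) ^+ N) (A t) [set: Sigma] rho.
  move=> t Pt; apply: (@acorr_limit _ _ _ _ _ C) => //.
  - by have [] := cA _ Pt.
  - exact: compact_sigma.
  move=> e e0.
  have rK1 : r ^+ K < 1 by rewrite exprn_ilt1 ?(ltW r0)// -?lt0n.
  have [N /ltW] := expr_small rK0 rK1 (divr_gt0 e0 C0).
  rewrite ler_pdivlMr// mulrC => Ne; have [rho rhoP] := app N _ Pt.
  by exists rho; exact: acorr_weak rhoP.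
elim: N => [|N IH] t Pt.
  have [_ [x0 Ax0]] := cA _ Pt.
  (* At level 0 all points are related, which needs a point on the symbolic side. Nothing is assumed
     on [m], so it is read off from a code or from a partner of a point in the remainder. *)
  have sg0 : exists y0 : Sigma, True.
    apply: contrapT => h; have [rho [_ tU _ _]] := corrU _ Pt.
    move: Ax0; rewrite (decA _ Pt) => -[[i /= ic _|_ /= /tU[y _]]]; last by apply: h; exists y.
    by apply: h; exists (fun _ => code t i (Ordinal K0)).
  have [y0 _] := sg0.
  exists (fun x _ => A t x); rewrite expr0 mulr1.
  split=> [x y //|x Ax|y _|x y x' y' Ax Ax']; [by exists y0|by exists x0|].
  have h1 := diamA _ Pt _ _ Ax Ax'; have h2 := sdist_le1 y y'.
  have := mdist_ge0 x x'; have := mdist_ge0 y y'; split; nra.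
(* The symbolic space is cut in the same pattern: coded cylinders, and the rest for the
   remainder. *)
pose tgt o := if o is Some i then catw (code t i) @` setT else free t.
have tgtT : \bigcup_(o in pieces t) tgt o = setT.
  apply/seteqP; split=> // y _.
  have [[i ic cy]|h] := pselect (exists2 i, i \in Ch t & code t i = prefix K y).
    by exists (Some i) => //; rewrite /tgt image_catw.
  by exists None => //= i ic cy; apply: h; exists i.
have /choice[rho rhoP] : forall o, exists rho, pieces t o ->
    acorr C (C * (r ^+ K) ^+ N.+1) (piece t o) (tgt o) rho.
  move=> [i|]; last first.
    have [rho rhoP] := corrU _ Pt; exists rho => _; exact: acorr_weak rhoP.
  have [ic|/negP ic] := boolP (i \in Ch t); last by exists (fun _ _ => True) => /ic.
  (* The inner approximation, scaled by [r ^+ K] on both sides, has the error of the next level. *)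
  have [rho rhoP] := IH _ (Psg _ _ Pt ic).
  eexists => _; rewrite exprS mulrCA.
  by apply: (acorr_scale rK0 (sim i) (sdist_catw (code t i)) rhoP).
exists (fun x y => exists2 o, pieces t o & rho o x y).
rewrite (decA _ Pt) -tgtT; apply: (@acorr_bigcup _ _ _ _ _ _ _ _ _ _ delta' D') => //.
- move=> o o' po po' oo' x x' Ax Ax'.
  by rewrite (le_trans _ (sepA _ Pt _ _ po po' oo' _ _ Ax Ax'))// ge_min lexx.
- move=> o o' po po' oo' y y' hy hy'.
  apply: (@le_trans _ _ (r ^+ K)); first by rewrite ge_min lexx orbT.
  apply: sdist_prefix => yy'; apply: oo'.
  case: o o' po po' hy hy' => [i|] [i'|] // ic ic'; rewrite /tgt ?image_catw /=.
  + by move=> yi y'i'; congr Some; apply: (injc _ Pt) => //; rewrite -yi -y'i'.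
  + by move=> yi /(_ _ ic); rewrite -yy' yi.
  + by move=> /(_ _ ic') + y'i'; rewrite yy' y'i'.
- by rewrite -(decA _ Pt) => x x' Ax Ax'; rewrite (le_trans (diamA _ Pt _ _ Ax Ax')).
- by move=> y y' _ _; exact: le_trans (sdist_le1 _ _) D'1.
- exact: ltW.
Qed.

End recursive_pieces.
End symbolic_space.

(** * Finite disjoint unions of copies of the symbolic space *)

Section unions.
Context {R : realType}.
Implicit Types X Y : metricType R.
Local Notation dist x y := (mdist x y : R).

Lemma bilip_setU X Y (A A' : set X) (B B' : set Y) (delta D : R) : 0 < delta ->
  bilip A B -> bilip A' B' ->
  (forall x x', A x -> A' x' -> delta <= mdist x x') ->
  (forall y y', B y -> B' y' -> delta <= mdist y y') ->
  diam_le D (A `|` A') -> diam_le D (B `|` B') ->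
  bilip (A `|` A') (B `|` B').
Proof.
move=> delta0 [C [rho [C0 cor]]] [C' [rho' [C'0 cor']]] sA sB dA dB.
have eU Z (E E' : set Z) :
    E `|` E' = \bigcup_(b in [set: bool]) (if b then E else E').
  apply/seteqP; split=> [z [zE|zE]|z [[] _ zE]]; [exists true|exists false|left|right] => //.
pose C2 := C + C' + `|D| / delta.
have D0 : 0 <= `|D| / delta by rewrite divr_ge0// ltW.
have C20 : 0 < C2 by rewrite ltr_wpDr// addr_gt0.
exists C2; eexists; split=> //.
rewrite !eU; apply: (@acorr_bigcup _ _ _ _ _ _ _
  (fun b => if b then rho else rho') _ _ delta `|D|) => //.
- move=> [] _; [apply: acorr_weak cor|apply: acorr_weak cor'] => //.
    by rewrite /C2; lra.
  by rewrite /C2; lra.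
- move=> [] [] _ _ bb x x' Ax Ax'; [by case: bb|exact: sA| |by case: bb].
  by rewrite dist_sym; exact: sA.
- move=> [] [] _ _ bb x x' Ax Ax'; [by case: bb|exact: sB| |by case: bb].
  by rewrite dist_sym; exact: sB.
- by rewrite -eU => x x' Ax Ax'; rewrite (le_trans (dA _ _ Ax Ax'))// ler_norm.
- by rewrite -eU => x x' Ax Ax'; rewrite (le_trans (dB _ _ Ax Ax'))// ler_norm.
- exact: ltW.
- rewrite /C2 !mulrDl divfK ?gt_eqF// lerDr -mulrDl.
  by apply: mulr_ge0; apply: ltW => //; exact: addr_gt0.
Qed.

Context {r : R} {hr : 0 < r < 1} {m : nat} (m2 : (2 <= m)%N).
Local Notation Sigma := (symbolic hr m).

Let r0 : 0 < r. Proof. by case/andP: hr. Qed.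

Let d0 : 'I_m := Ordinal (ltnW m2).
Let d1 : 'I_m := Ordinal m2.
Let w0 : {ffun 'I_1 -> 'I_m} := [ffun=> d0].

Lemma bilip_cylinder K (a : {ffun 'I_K -> 'I_m}) :
  bilip [set: Sigma] [set y : Sigma | prefix K y = a].
Proof.
rewrite -image_catw; apply: (@bilip_scale _ _ _ (r ^+ K)).
  exact: exprn_gt0.
exact: sdist_catw.
Qed.

(* Hilbert's hotel: the cylinder [0^n 1] is sent onto [0^(n+1) 1], and every
   other cylinder [0^n a], with a distinct from 0 and 1, is fixed. *)
Lemma bilip_hotel : bilip [set y : Sigma | y 0%N <> d1] [set: Sigma].
Proof.
pose A := [set y : Sigma | y 0%N <> d1].
pose U1 := catw w0 @` [set y : Sigma | y 0%N = d1].
pose U2 := [set y : Sigma | y 0%N <> d0 /\ y 0%N <> d1].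
have d01 : d0 <> d1 by [].
have U1E : U1 `<=` [set y | y 0%N = d0 /\ y 1%N = d1].
  move=> _ [y /= y0 <-]; rewrite (catw_ge w0 y 0).
  by rewrite (catw_lt w0 y ord0) ffunE.
have prE (y : Sigma) : (prefix 1 y = w0) <-> (y 0%N = d0).
  split=> [/ffunP/(_ ord0)|y0]; first by rewrite !ffunE.
  by apply/ffunP => i; rewrite !ffunE ord1.
(* Deleting the leading 0 takes the cylinder [01] onto [1], while the cylinders in [U2] stay
   fixed. *)
have corr : bilip (U1 `|` U2) [set y : Sigma | y 0%N <> d0].
  have -> : [set y : Sigma | y 0%N <> d0] = [set y | y 0%N = d1] `|` U2.
    apply/seteqP; split=> [y /= y0|y [/= ->|[]]]; rewrite ?eqE//.
      by have [yd1|yd1] := pselect (y 0%N = d1); [left|right].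
  apply: (@bilip_setU _ _ _ _ _ _ (r ^+ 1) 1); rewrite ?exprn_gt0//.
  - apply: bilip_sym; apply: (@bilip_scale _ _ _ (r ^+ 1)).
      exact: exprn_gt0.
    exact: sdist_catw.
  - exists 1, (fun x y => U2 x /\ x = y); split=> //.
    split=> [x y [? <-]//|x ?|y ?|x y x' y' [_ <-] [_ <-]].
    + by exists x.
    + by exists y.
    + by rewrite mul1r addr0.
  - move=> x x' /U1E[x0 _] [x'0 _]; apply: sdist_prefix => xx'.
    by apply: x'0; apply/prE; rewrite -xx'; apply/prE.
  - move=> y y' /= y0 [_ y'0]; apply: sdist_prefix => /ffunP/(_ ord0).
    by rewrite !ffunE /= y0 => /esym.
  - by move=> ? ? _ _; exact: sdist_le1.
  - by move=> ? ? _ _; exact: sdist_le1.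
have [C [rho [C0 rhoP]]] := corr.
(* There is a single type, containing one copy of itself behind the letter 0. Two letters separate
   this copy from the remainder, whence [r ^+ 2]. *)
apply: (@bilip_recursive _ _ hr m _ unit unit 1 setT (fun=> A) (fun=> U1 `|` U2)
  (fun=> [set: unit]%SET) (fun=> catw w0) id (fun _ _ => w0) 1 (r ^+ 2) C _ _ _ _ _ _ _ _ _ _ tt) => //.
- exact: exprn_gt0.
- move=> t _; split; last by exists (fun=> d0).
  have := @compact_prefix _ _ hr m 1 (fun w => w ord0 <> d1).
  by congr compact; apply/seteqP; split=> y; rewrite /A /= ffunE.
- by move=> i x y; exact: sdist_catw.
- move=> t _; apply/seteqP; split=> [y Ay|y [[[]|] _] /=].
  + have [y0|y0] := pselect (y 0%N = d0); last by exists None => //; right; split.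
    have [z yz] := catw_prefix 1 y; move: yz; have [_ ->] := prE y => // yz.
    have [z0|z0] := pselect (z 0%N = d1).
      by exists None => //; left; exists z.
    by exists (Some tt) => //=; exists z.
  + by move=> [z Az <-]; rewrite /A /= (catw_lt w0 z ord0) ffunE.
  + by move=> [/U1E[] + _|[]//]; rewrite /A /= => ->.
- have key (x y : Sigma) : A x -> (U1 `|` U2) y -> r ^+ 2 <= dist (catw w0 x) y.
    move=> Ax yU; apply: sdist_prefix => /ffunP xy.
    move: (xy ord0) (xy ord_max); rewrite !ffunE /= (catw_lt w0 x ord0) ffunE.
    rewrite (catw_ge w0 x 0) => xy0 xy1.
    case: yU => [/U1E[_ y1]|[y0 _]]; first by apply: Ax; rewrite xy1.
    exact: y0.
  move=> t _ [[]|] [[]|] _ _ oo x x' /=; [by case: oo| | |by case: oo].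
  + by move=> [z Az <-] x'U; exact: key.
  + by move=> xU [z Az <-]; rewrite dist_sym; exact: key.
- by move=> t _ ? ? _ _; exact: sdist_le1.
- by move=> t _ [] [].
- move=> [] _; exists rho.
  suff -> : free (fun=> [set: unit]%SET) (fun _ _ => w0) tt = [set y : Sigma | y 0%N <> d0].
    exact: rhoP.
  apply/seteqP; split=> y /=.
    by move=> /(_ tt (finset.in_setT _)) h y0; apply: h; symmetry; apply/prE.
  by move=> y0 _ _ /esym/prE.
Qed.

(** [A] is sent to the cylinder of [d1] and [A'] to its complement, which is a copy of the whole
    space by [bilip_hotel]. *)
Lemma bilip_sigmaU X (A A' : set X) (delta D : R) : 0 < delta ->
  bilip A [set: Sigma] -> bilip A' [set: Sigma] ->
  (forall x x', A x -> A' x' -> delta <= mdist x x') -> diam_le D (A `|` A') ->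
  bilip (A `|` A') [set: Sigma].
Proof.
move=> delta0 bA bA' sep dA; pose w1 : {ffun 'I_1 -> 'I_m} := [ffun=> d1].
have prE (y : Sigma) : (prefix 1 y = w1) <-> (y 0%N = d1).
  split=> [/ffunP/(_ ord0)|y0]; first by rewrite !ffunE.
  by apply/ffunP => i; rewrite !ffunE ord1.
pose B := [set y : Sigma | prefix 1 y = w1].
pose B' := [set y : Sigma | y 0%N <> d1].
have -> : [set: Sigma] = B `|` B'.
  by apply/seteqP; split=> // y _; have [/prE|] := pselect (y 0%N = d1); [left|right].
apply: (@bilip_setU _ _ _ _ _ _ (Num.min delta (r ^+ 1)) (Num.max D 1)).
- by rewrite lt_min delta0 exprn_gt0.
- exact: bilip_trans (bilip_cylinder w1).
- by apply: bilip_trans bA' _; apply: bilip_sym; exact: bilip_hotel.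
- by move=> x x' Ax Ax'; rewrite ge_min (sep _ _ Ax Ax').
- move=> y y' By B'y'; rewrite ge_min; apply/orP; right.
  by apply: sdist_prefix => yy'; apply: B'y'; apply/prE; rewrite -yy'.
- by move=> x x' Ax Ax'; rewrite le_max (dA _ _ Ax Ax').
- by move=> y y' _ _; rewrite le_max sdist_le1 orbT.
Qed.

Lemma bilip_sigma_bigcup X (I : finType) (Q : {set I}) (A : I -> set X)
    (delta D : R) : 0 < delta -> Q != finset.set0 ->
  (forall i, i \in Q -> bilip (A i) [set: Sigma]) ->
  separated delta [set` Q] A ->
  diam_le D (\bigcup_(i in [set` Q]) A i) ->
  bilip (\bigcup_(i in [set` Q]) A i) [set: Sigma].
Proof.
move=> delta0; have [n] := ubnP #|Q|; elim: n Q => // n IH Q Qn /finset.set0Pn[i iQ].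
move=> bA sep diam.
have [Q1|Q'0] := eqVneq (Q :\ i)%SET finset.set0.
  have -> : \bigcup_(j in [set` Q]) A j = A i; last exact: bA.
  apply/seteqP; split=> [x [j /= jQ Ajx]|x Aix]; last by exists i.
  have [<-//|ji] := eqVneq j i.
  have : j \in (Q :\ i)%SET by rewrite finset.in_setD1 ji.
  by rewrite Q1 finset.in_set0.
have E : \bigcup_(j in [set` Q]) A j =
    A i `|` \bigcup_(j in [set` (Q :\ i)%SET]) A j.
  apply/seteqP; split=> [x [j /= jQ Ajx]|x [Aix|[j /=]]].
  - have [<-|ji] := eqVneq j i; first by left.
    by right; exists j => //=; rewrite finset.in_setD1 ji.
  - by exists i.
  - by rewrite finset.in_setD1 => /andP[_ jQ] Ajx; exists j.
have Q'Q j : j \in (Q :\ i)%SET -> j \in Q by rewrite finset.in_setD1 => /andP[].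
rewrite E; apply: (@bilip_sigmaU _ _ _ delta D) => //.
- exact: bA.
- apply: IH => //.
  + by move: Qn; rewrite (cardsD1 i) iQ.
  + by move=> j /Q'Q; exact: bA.
  + by move=> j j' /= /Q'Q jQ /Q'Q j'Q; exact: sep.
  + by move=> x x' [j /= /Q'Q jQ Ax] [j' /= /Q'Q j'Q Ax']; apply: diam; [exists j|exists j'].
- move=> x x' Ax [j /=]; rewrite finset.in_setD1 => /andP[/eqP ji jQ] Ax'.
  by apply: (sep i j) => //; apply/nesym.
- by rewrite -E.
Qed.

(** This serves for the cylinders left free by an injective but not surjective coding. *)
Lemma bilip_prefix K (Q : {set {ffun 'I_K -> 'I_m}}) : Q != finset.set0 ->
  bilip [set y : Sigma | prefix K y \in Q] [set: Sigma].
Proof.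
move=> Q0.
have -> : [set y : Sigma | prefix K y \in Q] =
    \bigcup_(a in [set` Q]) [set y : Sigma | prefix K y = a].
  apply/seteqP; split=> [y yQ|y [a /= aQ ->]//].
  by exists (prefix K y).
apply: (@bilip_sigma_bigcup _ _ _ _ (r ^+ K) 1) => //.
- exact: exprn_gt0.
- by move=> a _; apply: bilip_sym; exact: bilip_cylinder.
- move=> a b _ _ ab x y /= xa yb; apply: sdist_prefix.
  by rewrite xa yb.
- by move=> x y _ _; exact: sdist_le1.
Qed.

End unions.

(** * Positive integral eigenvectors *)

Lemma finite_lower_bound (R : realType) (I : finType) (f : I -> R) :
  (forall i, 0 < f i) -> exists2 c : R, 0 < c & forall i, c <= f i.
Proof.
move=> f0; exists (\big[Num.min/1]_i f i); first by rewrite lt_bigmin.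
by move=> i; exact: bigmin_le.
Qed.

Lemma finite_upper_bound (R : realType) (I : finType) (f : I -> R) :
  exists2 c : R, 0 < c & forall i, f i <= c.
Proof.
exists (\big[Num.max/1]_i f i); first by apply: (lt_le_trans ltr01); exact: bigmax_ge_id.
by move=> i; exact: le_bigmax.
Qed.

Lemma clear_denominators (I : finType) (q : I -> rat) : (forall i, 0 < q i) ->
  exists (d : nat) (n : I -> nat), (0 < d)%N /\ forall i, (n i)%:R = d%:R * q i.
Proof.
move=> q0; pose de i := `|denq (q i)|%N; pose nu i := `|numq (q i)|%N.
have de0 i : (0 < de i)%N by rewrite absz_gt0 denq_neq0.
have qE i : q i = (nu i)%:R / (de i)%:R.
  rewrite -{1}[q i]divq_num_den /nu /de; congr (_ / _).
    by rewrite -{1}(@gez0_abs (numq (q i))) ?numq_ge0 ?ltW// pmulrn.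
  by rewrite -{1}(@gez0_abs (denq (q i))) ?denq_ge0// pmulrn.
exists (\prod_i de i)%N, (fun i => nu i * \prod_(k | k != i) de k)%N.
split; first by rewrite prodn_gt0.
move=> i; rewrite [X in _ = X%:R * _](bigD1 i)//= qE !natrM; field.
by rewrite pnatr_eq0 -lt0n.
Qed.

(* The eigenspace of an integral eigenvalue is defined over the rationals, so
   that rational eigenvectors are dense in it. *)
Lemma integral_eigenvector (R : realType) p (a : 'I_p -> 'I_p -> nat) (m : nat)
    (v : 'I_p -> R) : (forall i, 0 < v i) ->
  (forall i, \sum_j (a i j)%:R * v j = m%:R * v i) ->
  exists w : 'I_p -> nat, (forall i, 0 < w i)%N /\
    forall i, (\sum_j a i j * w j = m * w i)%N.
Proof.
(* The matrix is transposed because [kermx] is a kernel on row vectors. *)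
move=> v0 va; pose B : 'M[rat]_p := \matrix_(i, j) (a j i)%:R - m%:R%:M.
pose V : 'rV[R]_p := \row_j v j.
have VB : V *m map_mx ratr B = 0.
  rewrite map_mxB mulmxBr map_scalar_mx/= rmorph_nat mul_mx_scalar.
  apply/rowP => i; rewrite !mxE -[LHS]/(_ - _); apply/eqP; rewrite subr_eq0; apply/eqP.
  by rewrite -va; apply: eq_bigr => j _; rewrite !mxE rmorph_nat mulrC.
(* Kernels commute with extension of scalars, so the real eigenvector is a real combination, with
   coefficients [D], of rational ones. *)
have [k /submxP[D VD] kB] : exists2 k : 'M[rat]_p,
    (V <= map_mx (ratr : rat -> R) k)%MS & k *m B = 0.
  exists (kermx B); last exact: mulmx_ker.
  by rewrite map_kermx; apply/sub_kermxP.
pose S : R := \sum_i \sum_j `|ratr (k i j)|.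
have S0 : 0 <= S by rewrite !sumr_ge0// => i _; rewrite sumr_ge0.
have [c c0 cv] := finite_lower_bound v0.
have e0 : 0 < c / (S + 1) by rewrite divr_gt0// ltr_wpDl.
(* Rounding [D] to this precision moves each coordinate by at most [c * S / (S + 1) < c], which
   preserves positivity. *)
have /choice[D' D'P] : forall i, exists q : rat, `|D 0 i - ratr q| < c / (S + 1).
  move=> i; have : D 0 i < D 0 i + c / (S + 1) by rewrite ltrDl.
  move=> /rat_in_itvoo[q]; rewrite in_itv/= => /andP[q1 q2]; exists q.
  by rewrite distrC gtr0_norm ?subr_gt0// ltrBlDl.
pose w := \row_i D' i *m k.
have wB : w *m B = 0 by rewrite -mulmxA kB mulmx0.
have w0 j : 0 < w 0 j.
  rewrite -(ltr0q R) mxE raddf_sum/=.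
  have vj : v j = \sum_i D 0 i * ratr (k i j).
    have /rowP/(_ j) := VD; rewrite !mxE => ->.
    by apply: eq_bigr => i _; rewrite !mxE.
  have : `|v j - \sum_i ratr ((\row_i D' i) 0 i * k i j)| <= c / (S + 1) * S.
    rewrite vj -sumrB mulr_sumr (le_trans (ler_norm_sum _ _ _))// ler_sum// => i _.
    rewrite !mxE rmorphM/= -mulrBl normrM.
    apply: ler_pM => //; first exact: ltW.
    by rewrite (bigD1 j)//= lerDl sumr_ge0.
  have : c / (S + 1) * S < c.
    by rewrite -mulrA gtr_pMr// mulrC ltr_pdivrMr ?mul1r ?ltrDl// ltr_wpDl.
  have := cv j; rewrite ler_norml => ? ? /andP[_]; lra.
have [d [n [d0 nP]]] := clear_denominators w0.
exists n; split=> i; first by rewrite -(ltr_nat rat) nP mulr_gt0// ltr0n.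
apply/eqP; rewrite -(eqr_nat rat) natr_sum natrM nP; apply/eqP.
have /rowP/(_ i) := wB; rewrite mulmxBr mul_mx_scalar !mxE => /eqP.
rewrite subr_eq0 => /eqP wi; rewrite mulrCA -wi mulr_sumr.
by apply: eq_bigr => j _; rewrite natrM nP !mxE; ring.
Qed.

(** * Powers of a graph, idempotent reachability and terminal vertices *)

Section graph_powers.
Context {p : nat}.
Implicit Types G H : digraph p.

Definition gcomp G H : digraph p :=
  @Digraph p {x : edge G * edge H | tgt x.1 == src x.2}
    (fun x => src (val x).1) (fun x => tgt (val x).2).

(** The edges are the paths of length [n], with one empty path at each vertex for [n = 0]. *)
Fixpoint gpow G n : digraph p :=
  if n is n'.+1 then gcomp G (gpow G n') else @Digraph p 'I_p id id.

Definition joins G (i j : 'I_p) : bool :=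
  [exists e : edge G, (src e == i) && (tgt e == j)].

Lemma joinsP G i j :
  reflect (exists2 e : edge G, src e = i & tgt e = j) (joins G i j).
Proof.
apply: (iffP existsP) => [[e /andP[/eqP ? /eqP ?]]|[e ei ej]]; exists e => //.
by rewrite ei ej !eqxx.
Qed.

Lemma joins_edge G (e : edge G) : joins G (src e) (tgt e).
Proof. by apply/joinsP; exists e. Qed.

Lemma joins_comp G H i j :
  reflect (exists2 k, joins G i k & joins H k j) (joins (gcomp G H) i j).
Proof.
apply: (iffP (joinsP _ _ _)) => [[[[e f] /= ef] <- <-]|].
  by exists (tgt e); rewrite ?joins_edge// (eqP ef) joins_edge.
move=> [k /joinsP[e <- ek] /joinsP[f fk <-]].
have ef : tgt e == src f by rewrite ek fk.
by exists (exist _ (e, f) ef).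
Qed.

Lemma joins_pow0 G i j : joins (gpow G 0) i j = (i == j).
Proof. by apply/joinsP/eqP => [[k /= <- <-]//|->]; exists j. Qed.

Lemma joins_powD G a b i j :
  reflect (exists2 k, joins (gpow G a) i k & joins (gpow G b) k j)
    (joins (gpow G (a + b)) i j).
Proof.
elim: a i => [|a IH] i; apply: (iffP idP).
- by move=> h; exists i => //; rewrite joins_pow0.
- by move=> [k]; rewrite joins_pow0 => /eqP->.
- rewrite addSn => /joins_comp[k ik /IH[l kl lj]].
  by exists l => //; apply/joins_comp; exists k.
- move=> [k /joins_comp[l il lk] kj]; rewrite addSn.
  by apply/joins_comp; exists l => //; apply/IH; exists k.
Qed.

Lemma nat_pigeonhole (T : finType) (f : nat -> T) :
  exists a b, (a < b)%N /\ f a = f b.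
Proof.
apply: contrapT => h.
have inj : injective (fun i : 'I_(#|T|).+1 => f i).
  move=> i j fij; apply/val_inj; have [ij|ji|//] := ltngtP (val i) (val j).
    by exfalso; apply: h; exists i, j.
  by exfalso; apply: h; exists j, i.
by have := leq_card _ inj; rewrite card_ord ltnn.
Qed.

Definition idempotent_graph G :=
  forall i j, joins (gcomp G G) i j = joins G i j.

Lemma idempotentP G : idempotent_graph G ->
  forall i j, reflect (exists2 k, joins G i k & joins G k j) (joins G i j).
Proof. by move=> idG i j; rewrite -idG; exact: joins_comp. Qed.

(** The relations are powers of a Boolean matrix and hence eventually periodic. A multiple of the
    period that lies past the preperiod is an idempotent exponent. *)
Lemma exists_idempotent_pow G : exists2 n, (0 < n)%N & idempotent_graph (gpow G n).
Proof.
pose f n := [set x : 'I_p * 'I_p | joins (gpow G n) x.1 x.2]%SET.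
have [a [b [ab fab]]] := nat_pigeonhole f.
have fE n n' : (f n = f n') -> forall i j, joins (gpow G n) i j = joins (gpow G n') i j.
  by move=> /setP nn i j; have := nn (i, j); rewrite !finset.inE.
have per t : forall i j, joins (gpow G (a + t)) i j = joins (gpow G (b + t)) i j.
  move=> i j; apply/joins_powD/joins_powD => -[k ik kj]; exists k => //.
    by rewrite -(fE _ _ fab).
  by rewrite (fE _ _ fab).
pose c := (b - a)%N; have c0 : (0 < c)%N by rewrite subn_gt0.
have perk k n : (a <= n)%N -> forall i j, joins (gpow G (n + k * c)) i j = joins (gpow G n) i j.
  elim: k => [|k IH] an i j; first by rewrite addn0.
  rewrite -IH//; have -> : (n + k.+1 * c = b + (n + k * c - a))%N by rewrite /c; nia.
  by rewrite -per subnKC// (leq_trans an) ?leq_addr.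
exists (b * c)%N; first by rewrite muln_gt0 c0 (leq_ltn_trans _ ab).
move=> i j; rewrite -[RHS](perk b); first by apply/joins_comp/joins_powD.
by apply: leq_trans (ltnW ab) _; rewrite leq_pmulr.
Qed.

Lemma idempotent_pow G : idempotent_graph G -> forall k i j, (0 < k)%N ->
  joins (gpow G k) i j = joins G i j.
Proof.
move=> /idempotentP idG k i j; elim: k i => // -[_ i _|k IH i _].
  apply/joins_comp/idP => [[l il]|ij]; first by rewrite (joins_pow0 G) => /eqP<-.
  by exists j => //; rewrite (joins_pow0 G).
apply/joins_comp/idG => -[l il lj]; exists l => //; last by rewrite IH.
by rewrite -IH.
Qed.

Lemma sum_gcomp G H i (Q : pred 'I_p) (F : 'I_p -> nat) :
  (\sum_(x : edge (gcomp G H) | (src x == i) && Q (tgt x)) F (tgt x) =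
   \sum_(e : edge G | src e == i)
     \sum_(f : edge H | (src f == tgt e) && Q (tgt f)) F (tgt f))%N.
Proof.
rewrite pair_big_dep/=; symmetry.
rewrite (reindex_omap (val : edge (gcomp G H) -> _) insub) /=.
  apply: eq_bigl => x; rewrite valK eqxx andbT.
  by case: x => -[e f] /= ef; rewrite (eqP ef) eqxx.
by move=> [e f] /= /andP[_ /andP[fe _]]; rewrite insubT//= eq_sym.
Qed.

(** For idempotent [G] these are the vertices of the strongly connected components that no edge
    leaves. *)
Definition terminal G j :=
  joins G j j && [forall k, joins G j k ==> [forall l, joins G j l ==> joins G k l]].

Lemma terminalP G j : reflect
  (joins G j j /\ forall k l, joins G j k -> joins G j l -> joins G k l) (terminal G j).
Proof.
apply: (iffP andP) => -[jj h]; split=> //.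
  by move=> k l jk jl; move/forallP/(_ k)/implyP/(_ jk)/forallP/(_ l)/implyP: h; exact.
by apply/forallP => k; apply/implyP => jk; apply/forallP => l; apply/implyP; exact: h.
Qed.

Lemma joins_terminal G j k : idempotent_graph G -> terminal G j -> joins G j k ->
  terminal G k.
Proof.
move=> /idempotentP idG /terminalP[jj h] jk; apply/terminalP; split=> [|a b ka kb]; first exact: h.
by apply: h; apply/idG; exists k.
Qed.

(** A successor [j] of [i] with fewest successors has, by transitivity and minimality, the same
    successors as each of its successors; hence every successor of [j] is terminal. *)
Lemma exists_terminal G i : idempotent_graph G -> (forall i, exists j, joins G i j) ->
  exists2 j, joins G i j & terminal G j.
Proof.
move=> /idempotentP idG out; have [j0 ij0] := out i.
have [j ij jmin] := @arg_minnP _ j0 (joins G i) (fun j => #|joins G j|) ij0.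
have [k jk] := out j; exists k; first by apply/idG; exists j.
have same l : joins G j l -> joins G l =i joins G j.
  move=> jl; apply/subset_cardP.
    apply/eqP; rewrite eqn_leq jmin ?andbT; last by apply/idG; exists j.
    by apply/subset_leq_card/fintype.subsetP => a la; apply/idG; exists l.
  by apply/fintype.subsetP => a la; apply/idG; exists l.
apply/terminalP; split=> [|a b ka kb]; first by rewrite -[joins _ _ _]/(k \in joins G k) same.
rewrite -[joins _ _ _]/(b \in joins G a) same; last by apply/idG; exists k.
by apply/idG; exists k.
Qed.

End graph_powers.

(** * Iteration of the graph-directed system *)

Section systems.
Context {R : realType} {X : metricType R} {p : nat} (K : 'I_p -> set X) (v : 'I_p -> nat).

(** The hypotheses in a form inherited by iterates: [K] and [v] stay fixed, while [rho] and [mu]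
    become powers. *)
Definition system (rho : R) (mu : nat) (G : digraph p) (S : edge G -> X -> X) :=
  [/\ forall e, similarity rho (S e),
      forall i, K i = \bigcup_(e in [set e : edge G | src e = i]) (S e @` K (tgt e)),
      exists2 delta : R, 0 < delta & forall i,
        separated delta [set e : edge G | src e = i] (fun e => S e @` K (tgt e)) &
      forall i, (\sum_(e : edge G | src e == i) v (tgt e) = mu * v i)%N].

Definition mcomp (G H : digraph p) (S : edge G -> X -> X) (T : edge H -> X -> X)
  (x : edge (gcomp G H)) : X -> X := S (val x).1 \o T (val x).2.

Fixpoint mpow (G : digraph p) (S : edge G -> X -> X) n : edge (gpow G n) -> X -> X :=
  if n is n'.+1 return edge (gpow G n) -> X -> X then mcomp S (@mpow G S n')
  else fun=> id.

(** Distinct composite edges either differ in the first factor, with gap [d], or share it, and then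
    the gap [d'] is scaled by [rho]. *)
Lemma system_comp rho mu rho' mu' (G H : digraph p) (S : edge G -> X -> X)
    (T : edge H -> X -> X) : 0 < rho ->
  system rho mu S -> system rho' mu' T ->
  system (rho * rho') (mu * mu') (mcomp S T).
Proof.
move=> rho0 [simS KS [d d0 sepS] mS] [simT KT [d' d'0 sepT] mT]; split.
- by move=> [[e f] /= ef] x y; rewrite /mcomp/= simS simT mulrA.
- move=> i; apply/seteqP; split=> [x|].
    rewrite {1}KS => -[e /= ei [y + <-]]; rewrite {1}KT => -[f /= fe [z Kz <-]].
    have ef : tgt e == src f by rewrite fe.
    by exists (exist _ (e, f) ef) => //; exists z.
  move=> x [[[e f] /= ef] /= ei [z Kz <-]]; rewrite KS; exists e => //.
  by exists (T f z) => //; rewrite KT; exists f; [rewrite /= (eqP ef)|exists z].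
- exists (Num.min d (rho * d')); first by rewrite lt_min d0 mulr_gt0.
  move=> i [[e f] /= ef] [[e' f'] /= ef'] /= ei ei' ne _ _ [z Kz <-] [z' Kz' <-].
  rewrite /mcomp/= ge_min; have [ee'|/eqP ee'] := eqVneq e e'; last first.
    apply/orP; left; apply: (sepS i e e') => //.
      by exists (T f z) => //; rewrite KT; exists f; [rewrite /= (eqP ef)|exists z].
    by exists (T f' z') => //; rewrite KT; exists f'; [rewrite /= (eqP ef')|exists z'].
  subst e'; apply/orP; right; rewrite simS ler_pM2l//.
  apply: (sepT (tgt e) f f'); rewrite /= ?(eqP ef) ?(eqP ef')//.
  + by rewrite -(eqP ef) (eqP ef').
  + by move=> ff'; apply: ne; subst f'; congr exist; exact: bool_irrelevance.
  + by exists z.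
  + by exists z'.
- move=> i; have := sum_gcomp G H i xpredT v.
  under eq_bigl do rewrite andbT; move=> ->.
  under eq_bigr do under eq_bigl do rewrite andbT.
  under eq_bigr do rewrite mT.
  by rewrite -big_distrr/= mS; nia.
Qed.

Lemma system_pow rho mu (G : digraph p) (S : edge G -> X -> X) : 0 < rho ->
  system rho mu S -> forall n, system (rho ^+ n) (mu ^ n) (@mpow G S n).
Proof.
move=> rho0 sysS; elim=> [|n IH]; last by rewrite exprS expnS; exact: system_comp.
split=> [e x y|i||i] /=.
- by rewrite mul1r.
- apply/seteqP; split=> [x Kx|x [j /= -> [y Ky <-]]//].
  by exists i => //; exists x.
- exists 1 => // i j j' /= ji j'i jj'; by rewrite ji j'i in jj'.
- by rewrite big_pred1_eq mul1n.
Qed.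

End systems.

(** * Partition of weighted pieces into blocks of equal mass *)

Section blocks.
Local Open Scope nat_scope.

Lemma exists_fibers (T I : finType) (i0 : I) (D : {set T}) (x : I -> nat) :
  #|D| = \sum_i x i ->
  exists f : T -> I, forall i, #|[set e in D | f e == i]%SET| = x i.
Proof.
have [n] := ubnP #|D|; elim: n D x => // n IH D x Dn Dx.
have [D0|/finset.set0Pn[e eD]] := eqVneq D finset.set0.
  exists (fun=> i0) => i; have /eqP : \sum_i x i = 0 by rewrite -Dx D0 cards0.
  rewrite sum_nat_eq0 => /forallP/(_ i)/eqP->.
  by apply/eqP; rewrite cards_eq0; apply/eqP/setP => e; rewrite !finset.inE D0 finset.inE.
have [i xi] : exists i, 0 < x i.
  apply: contrapT => h; have : 0 < #|D| by apply/card_gt0P; exists e.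
  rewrite Dx big1// => i _; apply/eqP; rewrite -leqn0 leqNgt; apply/negP => xi.
  by apply: h; exists i.
have De : #|D| = #|(D :\ e)%SET|.+1 by rewrite (cardsD1 e) eD.
have [||f fP] := IH (D :\ e)%SET (fun j => x j - (j == i)).
- by rewrite De in Dn.
- apply/eqP; rewrite -(eqn_add2r 1) addn1 -De Dx (bigD1 i)//= [X in _ == X + _](bigD1 i)//= eqxx.
  rewrite addnAC subnK//; apply/eqP; congr addn; apply: eq_bigr => j /negbTE->.
  by rewrite subn0.
exists (fun e' => if e' == e then i else f e') => j.
rewrite (cardsD1 e) !finset.inE eqxx eD/=.
have -> : ([set e0 in D | (if e0 == e then i else f e0) == j] :\ e)%SET =
    [set e0 in (D :\ e)%SET | f e0 == j]%SET.
  by apply/setP => e'; rewrite !finset.inE; case: eqP.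
by rewrite fP [j == i]eq_sym; case: eqP => [<-|_]; rewrite ?subnKC ?subn0.
Qed.

(** A set of the common total size is labelled by [A] with fibre sizes [y] and by [B] with fibre
    sizes [h]; [z] counts the joint labels. *)
Lemma exists_transport (A B : finType) (a0 : A) (b0 : B) (y : A -> nat) (h : B -> nat) :
  \sum_a y a = \sum_b h b ->
  exists z : A -> B -> nat, (forall a, \sum_b z a b = y a) /\
    (forall b, \sum_a z a b = h b).
Proof.
move=> yh; pose T : finType := 'I_(\sum_a y a).
have [f fP] : exists f : T -> A, forall a, #|[set e in [set: T]%SET | f e == a]%SET| = y a.
  by apply: exists_fibers => //; rewrite cardsT card_ord.
have [g gP] : exists g : T -> B, forall b, #|[set e in [set: T]%SET | g e == b]%SET| = h b.
  by apply: exists_fibers => //; rewrite cardsT card_ord.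
exists (fun a b => \sum_(u | (f u == a) && (g u == b)) 1); split.
  move=> a; rewrite -fP -sum1_card -(partition_big g xpredT)//=.
  by apply: eq_bigl => u; rewrite !finset.inE.
move=> b; rewrite -gP -sum1_card.
under eq_bigr do under eq_bigl do rewrite andbC.
rewrite -(partition_big f xpredT)//=.
by apply: eq_bigl => u; rewrite !finset.inE.
Qed.

(** [d] is the least positive number congruent to a combination. Division with remainder shows that
    it divides each [w i]: modulo [L], the coefficient -1 can be replaced by [L - 1]. *)
Lemma exists_gcd_combination (I : finType) (C : {set I}) (w : I -> nat) (L : nat) :
  0 < L -> exists d (a : I -> nat), [/\ 0 < d, forall i, i \in C -> d %| w i,
    forall i, i \notin C -> a i = 0 & \sum_i a i * w i = d %[mod L]].
Proof.
move=> L0.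
pose P x := 0 < x /\ exists a : I -> nat,
  (forall i, i \notin C -> a i = 0) /\ \sum_i a i * w i = x %[mod L].
have exP : exists x, `[< P x >].
  exists L; apply/asboolP; split=> //; exists (fun=> 0); split=> //.
  by rewrite big1 ?modnn ?mod0n.
have [d /asboolP[d0 [a [aC aw]]] dmin] := ex_minnP exP.
exists d, a; split=> // i iC.
have [//|wd0] := posnP (w i %% d); first by move/eqP.
suff /asboolP/dmin : P (w i %% d) by rewrite leqNgt ltn_pmod.
split=> //; exists (fun j => (j == i) + (w i %/ d) * (L - 1) * a j); split.
  move=> j jC; rewrite aC// muln0 addn0; apply/eqP; rewrite eqb0.
  by apply: contraNneq jC => ->.
under eq_bigr do rewrite mulnDl -mulnA.
rewrite big_split/= -big_distrr/= (bigD1 i)//= eqxx mul1n big1 ?addn0; last first.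
  by move=> j /negbTE->.
rewrite -modnDmr -modnMmr aw modnMmr modnDmr.
rewrite {1}(divn_eq (w i) d) addnAC -mulnA -mulnDr.
rewrite (_ : d + (L - 1) * d = L * d); last by nia.
by rewrite mulnCA -modnDml modnMr.
Qed.

(* All blocks but one contain [a i] elements of colour [i], modulo [l i], the
   exceptional block absorbing the remainders; the rest is cut into packets of
   weight exactly [L]. *)
Lemma block_partition (T I : finType) (i0 : I) (D : {set T}) (c : T -> I) (w a : I -> nat)
    (M q : nat) (L := \prod_i w i) :
  (forall i, 0 < w i) -> 0 < q -> #|I| * L <= M ->
  \sum_(e in D) w (c e) = q * M ->
  \sum_i a i * w i = M %[mod L] ->
  (forall i, a i = 0 \/ q * L <= #|[set e in D | c e == i]%SET|) ->
  exists f : T -> 'I_q, forall b, \sum_(e in D | f e == b) w (c e) = M.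
Proof.
move=> w0 q0 LM DM aM plenty.
have L0 : 0 < L by rewrite /L prodn_gt0.
(* A packet of weight [L] consists of [l i] elements of colour [i]. *)
pose l i := \prod_(j | j != i) w j.
have lw i : l i * w i = L by rewrite /L (bigD1 i)//= mulnC.
have l0 i : 0 < l i by rewrite prodn_gt0.
pose n i := #|[set e in D | c e == i]%SET|.
have sumD (F : T -> nat) : \sum_(e in D) F e = \sum_i \sum_(e in D | c e == i) F e.
  exact: partition_big.
have nM : \sum_i n i * w i = q * M.
  rewrite -DM sumD; apply: eq_bigr => i _.
  rewrite (eq_bigr (fun=> w i)) => [|e /andP[_ /eqP->]//].
  rewrite sum_nat_const; congr (_ * _).
  by rewrite /n -!sum1_card; apply: eq_bigl => e; rewrite finset.inE.
have ltL (x : I -> nat) : (forall i, x i < l i) -> \sum_i x i * w i <= M.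
  move=> xl; apply: leq_trans LM; rewrite -sum_nat_const leq_sum// => i _.
  by rewrite -(lw i) leq_pmul2r// ltnW.
(* Dropping whole packets keeps the weight modulo [L] and makes it at most [M], so that some number
   [h] of packets completes the block. *)
pose a' i := a i %% l i.
have a'w : \sum_i a' i * w i <= M by apply: ltL => i; rewrite ltn_pmod.
have [h hM] : exists h, M = \sum_i a' i * w i + h * L.
  exists ((M - \sum_i a' i * w i) %/ L); rewrite divnK ?subnKC//.
  have aE : \sum_i a i * w i = (\sum_i a i %/ l i) * L + \sum_i a' i * w i.
    rewrite big_distrl -big_split/=; apply: eq_bigr => i _.
    by rewrite {1}(divn_eq (a i) (l i)) mulnDl -mulnA lw.
  by rewrite -eqn_mod_dvd// -aM aE modnMDl.
(* From here on there are [q.+1] blocks: [q] regular ones and the exceptional one, with index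
   [ord0]. *)
case: q q0 DM nM plenty => // q _ DM nM plenty.
have qn i : q * a' i <= n i.
  have [ai|] := plenty i; first by rewrite /a' ai mod0n muln0.
  apply: leq_trans; apply: leq_mul => //; apply: (@leq_trans (l i)).
    by rewrite ltnW// ltn_pmod.
  by rewrite -(lw i) leq_pmulr.
(* Once the regular blocks have received [a' i] elements each, [y i] packets remain, and [c0 i]
   elements too few for a packet, which go to the exceptional block. *)
pose c0 i := (n i - q * a' i) %% l i; pose y i := (n i - q * a' i) %/ l i.
have nE i : n i = q * a' i + (c0 i + l i * y i).
  by rewrite /c0 /y addnC [l i * _]mulnC [_ %% _ + _]addnC -divn_eq subnK.
have c0w : \sum_i c0 i * w i <= M by apply: ltL => i; rewrite ltn_pmod.
have balance : M + q * h * L = \sum_i c0 i * w i + L * \sum_i y i.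
  have : \sum_i n i * w i = q * \sum_i a' i * w i + (\sum_i c0 i * w i + L * \sum_i y i).
    rewrite !big_distrr -!big_split/=; apply: eq_bigr => i _.
    by rewrite [in LHS]nE -(lw i); ring.
  by rewrite nM => E; apply/eqP; rewrite -(eqn_add2l (q * \sum_i a' i * w i)) -E {2}hM; apply/eqP; nia.
(* Since the leftovers weigh at most [M], there are enough packets for the regular blocks; the
   surplus [h0] completes the exceptional one. *)
have hy : q * h <= \sum_i y i by rewrite -(leq_pmul2r L0); nia.
pose h0 := \sum_i y i - q * h.
have h0M : M = \sum_i c0 i * w i + h0 * L by rewrite /h0 mulnBl; nia.
pose hh (b : 'I_q.+1) := if b == ord0 then h0 else h.
have yhh : \sum_i y i = \sum_b hh b.
  rewrite big_ord_recl /hh eqxx [X in _ = _ + X](eq_bigr (fun=> h)) => [|b _ //].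
  by rewrite big_const_ord iter_addn_0 (mulnC h) /h0 subnK.
have [z [zy zh]] := exists_transport i0 ord0 yhh.
pose x i (b : 'I_q.+1) := (if b == ord0 then c0 i else a' i) + l i * z i b.
have xn i : n i = \sum_b x i b.
  rewrite nE addnA big_split/= -big_distrr/= zy; congr addn.
  rewrite big_ord_recl eqxx [X in _ = _ + X](eq_bigr (fun=> a' i)) => [|b _ //].
  by rewrite big_const_ord iter_addn_0 (mulnC (a' i)) addnC.
have /choice[f fP] : forall i, exists f : T -> 'I_q.+1,
    forall b, #|[set e in [set e in D | c e == i]%SET | f e == b]%SET| = x i b.
  by move=> i; exact: (exists_fibers ord0 (xn i)).
exists (fun e => f (c e) e) => b.
rewrite (partition_big c xpredT)//=.
under eq_bigr => i _.
  rewrite (eq_bigr (fun=> w i)); last by move=> e /andP[_ /eqP->].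
  rewrite sum_nat_const (_ : #|_| = x i b); last first.
    rewrite -fP -!sum1_card; apply: eq_bigl => e.
    by rewrite -topredE/= !finset.inE andbAC; case: eqP => [->|]; rewrite ?andbF.
  rewrite /x mulnDl mulnAC lw; over.
rewrite big_split/= -big_distrr/= zh /hh.
by case: eqP => _; [rewrite [RHS]h0M|rewrite [RHS]hM]; rewrite mulnC [_ * L]mulnC.
Qed.

End blocks.

Lemma exists_code (I J : finType) (A : {set I}) (j0 : J) : (#|A| <= #|J|)%N ->
  exists f : I -> J, {in A &, injective f}.
Proof.
move=> AJ; exists (fun i => nth j0 (enum J) (index i (enum A))) => i j iA jA.
have lt k : k \in A -> (index k (enum A) < size (enum J))%N.
  by move=> kA; rewrite -cardE (leq_trans _ AJ)// cardE index_mem mem_enum.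
move/eqP; rewrite nth_uniq ?enum_uniq ?lt// => /eqP ij.
have := congr1 (nth i (enum A)) ij.
by rewrite !nth_index ?mem_enum.
Qed.

(** * Compactness and diameters *)

Section compact_metric.
Context {R : realType} {X : metricType R}.
Local Notation dist x y := (mdist x y : R).

Lemma compact_similarity (rho : R) (f : X -> X) (A : set X) : 0 < rho ->
  similarity rho f -> compact A -> compact (f @` A).
Proof.
move=> rho0 sim; apply: continuous_compact; apply: continuous_subspaceT => x.
apply/(@metricType_numDomainType.cvgrPdist_lt R X) => e e0.
have : \forall y \near x, mdist x y < e / rho.
  by apply/metricType_numDomainType.nbhs_mdistP; exists (e / rho) => //=; exact: divr_gt0.
apply: filterS => y; rewrite sim => xy.
by rewrite mulrC -ltr_pdivlMr.
Qed.

Lemma compact_diam (A : set X) : compact A -> exists D : R, diam_le D A.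
Proof.
move=> cA; have [U [u [UU u0 Usmall]]] := @ultra_oo R.
have UF : Filter U by exact: _.
apply: contrapT => h.
have /choice[f Hf] : forall n, exists xy : X * X,
    [/\ A xy.1, A xy.2 & (u n)^-1 < dist (xy.1) (xy.2)].
  move=> n; apply: contrapT => hn; apply: h; exists (u n)^-1 => x y Ax Ay.
  by rewrite leNgt; apply/negP => xy; apply: hn; exists (x, y).
have [x Ax Hx] : exists2 x, A x & forall e, 0 < e -> U [set n | mdist x (f n).1 < e].
  by apply: ultra_lim => // n; have [] := Hf n.
have [y Ay Hy] : exists2 y, A y & forall e, 0 < e -> U [set n | mdist y (f n).2 < e].
  by apply: ultra_lim => // n; have [] := Hf n.
have xy3 : 0 < dist x y + 3 by have : 0 <= dist x y by [exact: mdist_ge0]; lra.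
have i3 : 0 < (dist x y + 3)^-1 by rewrite invr_gt0.
have /filter_ex[n [[/= h1 h2]]] :=
  @filterI _ U UF _ _ (@filterI _ U UF _ _ (Hx _ ltr01) (Hy _ ltr01)) (Usmall _ i3).
rewrite -[ltLHS]invrK ltf_pV2 ?posrE ?invr_gt0// => h3.
have [_ _ h4] := Hf n.
have := dist_triangle (f n).1 x (f n).2; have := dist_triangle x y (f n).2.
rewrite (dist_sym _ x) => ? ?; lra.
Qed.

Lemma compact_bigcup (I : finType) (Q : {set I}) (A : I -> set X) :
  (forall i, i \in Q -> compact (A i)) -> compact (\bigcup_(i in [set` Q]) A i).
Proof. by move=> cA; rewrite bigcup_pred; exact: bigsetU_compact. Qed.

End compact_metric.

(** * Coding of terminal and nonterminal sets *)

Section codings.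
Context {R : realType} {r : R} {hr : 0 < r < 1} {m : nat} (m2 : (2 <= m)%N).
Context {X : metricType R} {p : nat} (K : 'I_p -> set X) (v : 'I_p -> nat).
Context (D : R) (diamX : diam_le D [set: X]).
Hypothesis K_compact : forall i, compact (K i).
Hypothesis K_neq0 : forall i, K i !=set0.
Hypothesis v_gt0 : forall i, (0 < v i)%N.
Local Notation Sigma := (symbolic hr m).

Let r0 : 0 < r. Proof. by case/andP: hr. Qed.

Let diamA (A : set X) : diam_le D A.
Proof. by move=> x y _ _; exact: diamX. Qed.

(** The recursion runs over pairs of a vertex and a block. The pieces in a block of mass [M] split
    again into blocks of mass [M], of total mass [m ^ n * M]. There are thus [m ^ n] sub-blocks, and
    every word of length [n] is a code. *)
Lemma bilip_blocks n (G : digraph p) (S : edge G -> X -> X) (C : pred 'I_p) (M : nat)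
    (q : 'I_p -> nat) (blk : edge G -> nat) : (0 < n)%N ->
  system K v (r ^+ n) (m ^ n) S ->
  (forall e : edge G, C (src e) -> C (tgt e)) ->
  (0 < M)%N -> (forall j, C j -> 0 < q j /\ q j * M = m ^ n * v j)%N ->
  (forall e : edge G, C (src e) -> (blk e < q (src e))%N) ->
  (forall j b, C j -> (b < q j)%N ->
    (\sum_(e : edge G | (src e == j) && (blk e == b)) v (tgt e) = M)%N) ->
  forall j, C j -> bilip (K j) [set: Sigma].
Proof.
move=> n0 [simS KS [d d0 sepS] mS] Cclosed M0 qP blkP sumM.
have rn0 : 0 < r ^+ n by exact: exprn_gt0.
(* A common bound puts all block numbers into one finite type. *)
pose Q := (\max_j q j)%N.
have qQ j b : (b < q j)%N -> (b < Q.+1)%N.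
  by move=> bq; rewrite ltnS ltnW// (leq_trans bq)// leq_bigmax.
pose F (e : edge G) := S e @` K (tgt e).
pose blocks (t : 'I_p * 'I_Q.+1) := [set e | (src e == t.1) && (blk e == t.2)]%SET.
pose A t := \bigcup_(e in [set` blocks t]) F e.
pose P := [set t : 'I_p * 'I_Q.+1 | C t.1 /\ (t.2 < q t.1)%N].
pose Ch t := [set i : edge G * 'I_Q.+1 | (i.1 \in blocks t) && (i.2 < q (tgt i.1))%N]%SET.
have KE j : C j -> K j = \bigcup_(b in [set` [set b : 'I_Q.+1 | (b < q j)%N]%SET]) A (j, b).
  move=> Cj; rewrite KS; apply/seteqP; split=> [x [e /= ej Fx]|x [b /= _ [e]]].
    have eq : (blk e < q j)%N by rewrite -ej blkP// ej.
    exists (inord (blk e)); rewrite /= ?finset.inE ?inordK ?(qQ j)//.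
    by exists e => //; rewrite /= finset.inE/= ej inordK ?(qQ j)// !eqxx.
  by rewrite /= finset.inE => /andP[/eqP/= ej _] Fx; exists e.
have ChE t : P t -> #|Ch t| = #|{ffun 'I_n -> 'I_m}|.
  move=> [Ct tq]; rewrite card_ffun !card_ord; apply/eqP; rewrite -(eqn_pmul2r M0); apply/eqP.
  rewrite -[in RHS](sumM _ _ Ct tq) big_distrr/=.
  have -> : #|Ch t| = (\sum_(e in blocks t) q (tgt e))%N.
    rewrite -sum1_card (eq_bigl (fun i : edge G * 'I_Q.+1 => (i.1 \in blocks t) && (i.2 < q (tgt i.1))%N)); last first.
      by move=> i; rewrite finset.inE.
    rewrite -(pair_big_dep (fun e => e \in blocks t) (fun e (b : 'I_Q.+1) => (b < q (tgt e))%N) (fun _ _ => 1%N))/=.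
    apply: eq_bigr => e _.
    have qe : (q (tgt e) <= Q.+1)%N by rewrite ltnW// ltnS leq_bigmax.
    by rewrite -(big_ord_widen _ (fun=> 1%N) qe) sum1_card card_ord.
  rewrite big_distrl/=; apply: eq_big => e; first by rewrite finset.inE.
  rewrite finset.inE => /andP[/eqP ej _].
  by have [] := qP (tgt e) (Cclosed e _); rewrite ?ej.
have m0 : (0 < m)%N by exact: leq_trans m2.
have w0 : {ffun 'I_n -> 'I_m} by exact: [ffun=> Ordinal m0].
have /choice[code codeP] : forall t, exists f : edge G * 'I_Q.+1 -> {ffun 'I_n -> 'I_m},
    P t -> {in Ch t &, injective f}.
  move=> t; have [Pt|nPt] := pselect (P t); last by exists (fun=> w0).
  have [f fP] := @exists_code _ _ (Ch t) w0 (eq_leq (ChE _ Pt)).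
  by exists f.
have AK t : P t -> A t `<=` K t.1.
  by move=> [Ct tq] x Ax; rewrite KE//; exists t.2; rewrite /= ?finset.inE// -surjective_pairing.
have sepA t t' x x' : P t -> P t' -> t.1 = t'.1 -> t.2 <> t'.2 -> A t x -> A t' x' -> d <= mdist x x'.
  move=> _ _ t1 t2 [e /=]; rewrite finset.inE => /andP[/eqP e1 /eqP e2] Fx.
  move=> [e' /=]; rewrite finset.inE => /andP[/eqP e'1 /eqP e'2] Fx'.
  apply: (sepS t.1 e e') => //=; first by rewrite t1.
  by move=> ee'; apply: t2; apply: val_inj; rewrite /= -e2 -e'2 ee'.
have bA t : P t -> bilip (A t) [set: Sigma].
  (* Sub-blocks of different pieces have gap [d]; those of one piece have the gap between blocks,
     scaled by [r ^+ n]. *)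
  apply: (@bilip_recursive _ _ hr m _ _ _ n P A (fun=> set0) Ch (fun i => S i.1)
    (fun i => (tgt i.1, i.2)) code D (Num.min d (r ^+ n * d)) 1) => //.
  - by rewrite lt_min d0 mulr_gt0.
  - move=> {}t [Ct tq]; split.
      by apply: compact_bigcup => e _; exact: (compact_similarity rn0).
    have [e et] : exists e, e \in blocks t.
      apply: contrapT => h; move: M0; rewrite -(sumM _ _ Ct tq) big1// => e et.
      by exfalso; apply: h; exists e; rewrite finset.inE.
    by have [x Kx] := K_neq0 (tgt e); exists (S e x), e => //; exists x.
  - move=> {}t i [Ct tq]; rewrite !finset.inE => /andP[/andP[/eqP it _] iq]; split=> //=.
    by apply: Cclosed; rewrite it.
  - by move=> i x y; exact: simS.
  - move=> {}t [Ct tq]; apply/seteqP; split.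
      move=> x [e /= et [y Ky <-]].
      have Ce : C (tgt e).
        by apply: Cclosed; move: et; rewrite finset.inE => /andP[/eqP->].
      move: Ky; rewrite KE// => -[b /=]; rewrite finset.inE => bq Ay.
      exists (Some (e, b)); first by rewrite /pieces /= finset.inE et.
      by exists y.
    move=> x [[[e b]|] //=]; rewrite finset.inE /= => /andP[et bq] [y Ay <-].
    exists e => //; exists y => //; apply: (AK (tgt e, b)) => //; split=> //=.
    by apply: Cclosed; move: et; rewrite finset.inE => /andP[/eqP->].
  - move=> {}t [Ct tq] [[e b]|] [[e' b']|] //; rewrite /pieces /= !finset.inE /=.
    move=> /andP[/andP[/eqP et _] bq] /andP[/andP[/eqP et' _] bq'] ne _ _ [y Ay <-] [y' Ay' <-].
    have Ce : C (tgt e) by apply: Cclosed; rewrite et.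
    have Ce' : C (tgt e') by apply: Cclosed; rewrite et'.
    rewrite ge_min; have [ee'|/eqP ee'] := eqVneq e e'.
      subst e'; apply/orP; right; rewrite simS ler_pM2l//.
      apply: (sepA (tgt e, b) (tgt e, b')) => //= bb'.
      by apply: ne; rewrite bb'.
    apply/orP; left; apply: (sepS t.1 e e') => //.
    + by exists y => //; exact: (AK (tgt e, b)).
    + by exists y' => //; exact: (AK (tgt e', b')).
  (* As many codes as words leave no free cylinder, so the empty relation suffices. *)
  - move=> {}t Pt; exists (fun _ _ => False); split=> // y fy.
    have := @subset_cardP _ (code t @: Ch t)%SET [set: {ffun 'I_n -> 'I_m}]%SET.
    rewrite card_in_imset; last exact: codeP.
    rewrite cardsT ChE// => /(_ erefl)/= h.
    have := (elimT h (finset.subsetT _)) (prefix n y).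
    rewrite finset.in_setT => /imsetP[i it yi].
    by case: (fy i it).
move=> j Cj; rewrite KE//; apply: (bilip_sigma_bigcup m2 (delta := d) (D := D)) => //.
- have [qj _] := qP _ Cj.
  by apply/finset.set0Pn; exists ord0; rewrite finset.inE.
- by move=> b; rewrite finset.inE => bq; apply: bA.
- move=> b b' /=; rewrite !finset.inE => bq b'q bb' x x'.
  exact: (sepA (j, b) (j, b')).
Qed.

Section idempotent_system.
Context (n0 : nat) (n0_gt0 : (0 < n0)%N) (G : digraph p) (S : edge G -> X -> X).
Hypothesis sysG : system K v (r ^+ n0) (m ^ n0) S.
Hypothesis idG : idempotent_graph G.

Let mu := (m ^ n0)%N.
Let N := (\sum_i v i)%N.

Let mu_gt1 : (1 < mu)%N.
Proof. by rewrite /mu -(expn0 m) ltn_exp2l. Qed.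

Let v_le i : (v i <= N)%N.
Proof. by rewrite /N (bigD1 i)//= leq_addr. Qed.

Lemma system_iter k : system K v (r ^+ (n0 * k)) (m ^ (n0 * k)) (@mpow _ _ _ _ S k).
Proof. by rewrite exprM expnM; apply: system_pow sysG _; exact: exprn_gt0. Qed.

(** This supplies the pieces of each type that [block_partition] demands. Every first edge leads to
    a terminal vertex joined to [i], so conservation of mass multiplies the bound by [mu] at each
    step. *)
Lemma path_count j i k : terminal G j -> joins G j i ->
  (v j * mu ^ k.+1 <= N * mu *
    #|[set e : edge (gpow G k.+1) | (src e == j) && (tgt e == i)]%SET|)%N.
Proof.
have [_ _ _ mass] := sysG.
elim: k j => [|k IH] j tj ji.
  have /joinsP[e ej ei] : joins (gpow G 1) j i by rewrite idempotent_pow.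
  have : (0 < #|[set e : edge (gpow G 1) | (src e == j) && (tgt e == i)]%SET|)%N.
    by apply/card_gt0P; exists e; rewrite finset.inE ej ei !eqxx.
  move=> n_gt0; rewrite expn1; apply: leq_trans (leq_pmulr _ n_gt0).
  by rewrite leq_mul2r v_le orbT.
have E (k' : nat) (j' : 'I_p) : #|[set e : edge (gpow G k') | (src e == j') && (tgt e == i)]%SET| =
    (\sum_(e : edge (gpow G k') | (src e == j') && (tgt e == i)) 1)%N.
  by rewrite -sum1_card; apply: eq_bigl => e; rewrite finset.inE.
rewrite E (sum_gcomp G (gpow G k.+1) j (pred1 i) (fun=> 1%N)) big_distrr/=.
apply: (@leq_trans (\sum_(e : edge G | src e == j) v (tgt e) * mu ^ k.+1)).
  by rewrite -big_distrl/= mass -/mu [in X in (X <= _)%N]expnS; nia.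
apply: leq_sum => e /eqP ej; rewrite -(E k.+1).
have [_ h] := terminalP _ _ tj; have jt : joins G j (tgt e) by rewrite -ej joins_edge.
by apply: IH; [exact: joins_terminal jt|exact: h].
Qed.

Lemma bilip_terminal j : terminal G j -> bilip (K j) [set: Sigma].
Proof.
move=> tj; pose C := joins G j.
have [jj jC] := terminalP _ _ tj.
pose L := (\prod_i v i)%N; have L0 : (0 < L)%N by rewrite prodn_gt0.
have [d [a [d0 dC aC aw]]] := exists_gcd_combination [set i | C i]%SET v L0.
(* The summands make [mu ^ l] exceed [N * mu * L], for a sufficient number of pieces of each type,
   and [p * L], for a sufficient block mass. *)
pose l := (N * mu * L + p * L)%N; pose M := (d * mu ^ l)%N.
have lmu : (l < mu ^ l)%N by exact: ltn_expl.
have mul0 : (0 < mu ^ l)%N by rewrite expn_gt0 ltnW.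
have M0 : (0 < M)%N by rewrite muln_gt0 d0.
pose q i := (v i %/ d * mu)%N.
have qM i : C i -> (0 < q i /\ q i * M = m ^ (n0 * l.+1) * v i)%N.
  move=> Ci; have dv : (d %| v i)%N by apply: dC; rewrite finset.inE.
  split; first by rewrite muln_gt0 divn_gt0// dvdn_leq//= ltnW.
  rewrite expnM -/mu expnS -[in RHS](divnK dv) /q /M; ring.
have /choice[f fP] : forall i, exists f : edge (gpow G l.+1) -> nat, C i ->
    (forall e, src e = i -> (f e < q i)%N) /\ forall b, (b < q i)%N ->
    (\sum_(e : edge (gpow G l.+1) | (src e == i) && (f e == b)) v (tgt e) = M)%N.
  move=> i; have [Ci|nCi] := boolP (C i); last by exists (fun=> 0%N).
  have [qi0 qiM] := qM _ Ci.
  pose E := [set e : edge (gpow G l.+1) | src e == i]%SET.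
  (* Multiplying [a] by [mu ^ l] turns the residue [d] into [M]. Types outside [C] have coefficient
     0 and need no supply. *)
  have [||||f fP] := @block_partition _ _ i E (fun e : edge (gpow G l.+1) => tgt e) v (fun c => a c * mu ^ l)%N M (q i) v_gt0 qi0.
  - rewrite card_ord -/L /M; nia.
  - have [_ _ _ mass] := system_iter l.+1.
    by rewrite qiM -mass; apply: eq_bigl => e; rewrite finset.inE.
  - under eq_bigr do rewrite mulnAC.
    by rewrite -big_distrl/= -/L -modnMml aw modnMml.
  - move=> c; have [cC|cC] := boolP (C c); last by left; rewrite aC ?finset.inE.
    right; rewrite -/L.
    have -> : [set e in E | tgt e == c]%SET =
        [set e : edge (gpow G l.+1) | (src e == i) && (tgt e == c)]%SET.
      by apply/setP => e; rewrite !finset.inE.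
    have ti : terminal G i by exact: joins_terminal Ci.
    have := path_count l ti (jC _ _ Ci cC).
    set x := #|_| => count; rewrite -(leq_pmul2l (_ : 0 < N * mu)%N); last first.
      by rewrite muln_gt0 (leq_trans (v_gt0 j))//= ltnW.
    apply: leq_trans count; rewrite expnS.
    have qv : (q i <= v i * mu)%N by rewrite leq_mul2r leq_div orbT.
    have lL : (N * mu * L <= mu ^ l)%N by rewrite ltnW// (leq_ltn_trans _ lmu)// leq_addr.
    rewrite mulnCA [leqRHS]mulnA; exact: leq_mul.
  exists f => _; split=> [e _|b bq]; first exact: ltn_ord.
  rewrite -[RHS](fP (Ordinal bq)); apply: eq_bigl => e.
  by rewrite finset.inE.
apply: (bilip_blocks (n := n0 * l.+1) (C := C) (M := M) (q := q)
  (blk := fun e => f (src e) e) _ (system_iter l.+1)) => //.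
- by rewrite muln_gt0 n0_gt0.
- move=> e Ce; apply/(idempotentP idG); exists (src e) => //.
  by rewrite -(idempotent_pow idG (k := l.+1))// joins_edge.
- by move=> e Ce; have [h _] := fP _ Ce; exact: h.
- move=> i b Ci bq; have [_ h] := fP _ Ci; rewrite -(h _ bq).
  by apply: eq_bigl => e; case: eqP => [->|].
Qed.

(** Every vertex has an edge, of mass at least 1, to a terminal vertex, and no path returns from
    there. As [v j <= N], each step multiplies the nonterminal fraction of the mass by at most
    [1 - 1 / (N * mu)]. *)
Lemma nonterminal_mass j k :
  (N ^ k * \sum_(e : edge (gpow G k) | (src e == j) && ~~ terminal G (tgt e)) v (tgt e)
    <= v j * (N * mu - 1) ^ k)%N.
Proof.
have [_ _ _ mass] := sysG.
have out i : exists i', joins G i i'.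
  apply: contrapT => h; have := mass i; rewrite big1 => [|e /eqP ei].
    by move/esym/eqP; rewrite muln_eq0 expn_eq0 eqn0Ngt (ltnW m2)/= eqn0Ngt v_gt0.
  by exfalso; apply: h; exists (tgt e); rewrite -ei joins_edge.
have term i k' : terminal G i ->
    (\sum_(e : edge (gpow G k') | (src e == i) && ~~ terminal G (tgt e)) v (tgt e) = 0)%N.
  move=> ti; rewrite big_pred0// => e; apply/negbTE/negP => /andP[/eqP ei /negP]; apply.
  have : joins (gpow G k') i (tgt e) by rewrite -ei joins_edge.
  case: k' e ei => [|k'] e ei; first by rewrite joins_pow0 => /eqP<-.
  by rewrite idempotent_pow//; exact: joins_terminal ti.
elim: k j => [|k IH] j.
  rewrite !expn0 mul1n muln1 big_mkcondr/= (big_pred1 j)//=.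
  by case: ifP.
rewrite (sum_gcomp G (gpow G k) j (fun i => ~~ terminal G i) v) expnS -mulnA big_distrr/=.
apply: (@leq_trans (N * \sum_(e : edge G | (src e == j) && ~~ terminal G (tgt e))
    v (tgt e) * (N * mu - 1) ^ k)).
  rewrite leq_mul2l; apply/orP; right.
  rewrite (bigID (fun e => terminal G (tgt e)))/= big1 => [|e /andP[_ te]]; last first.
    by rewrite term// muln0.
  by rewrite add0n; apply: leq_sum => e _; exact: IH.
rewrite -big_distrl/= mulnA expnS [leqRHS]mulnA; apply: leq_mul => //.
have [t jt tt] := exists_terminal j idG out.
have [e ej et] := joinsP _ _ _ jt.
have := mass j; rewrite (bigID (fun e => terminal G (tgt e)))/= (bigD1 e) ?ej ?et ?eqxx ?tt//=.
by have := v_le j; have := v_gt0 t; have := v_gt0 j; rewrite -/mu; nia.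
Qed.

(** Bernoulli's inequality for [1 + 1 / (b - 1)], with denominators cleared. *)
Lemma exists_exp_lt (a b : nat) : (1 < b)%N -> exists2 k, (0 < k)%N & (a * (b - 1) ^ k < b ^ k)%N.
Proof.
case: b => // b; rewrite ltnS => b0.
have bernoulli k : (b ^ k * (b + k) <= b.+1 ^ k * b)%N.
  elim: k => [|k IH]; first by rewrite addn0.
  rewrite !expnS; nia.
exists (a * b + 1)%N; first by rewrite addn1.
rewrite subn1/= -(ltn_pmul2r (_ : 0 < b)%N)//.
apply: leq_trans (bernoulli _).
have : (0 < b ^ (a * b + 1))%N by rewrite expn_gt0 b0.
move: (b ^ _)%N => x; nia.
Qed.

Lemma bilip_idempotent j : bilip (K j) [set: Sigma].
Proof.
have [tj|ntj] := boolP (terminal G j); first exact: bilip_terminal.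
have N0 : (0 < N)%N by exact: leq_trans (v_gt0 j) (v_le j).
have Nmu : (1 < N * mu)%N by rewrite (leq_trans mu_gt1)// leq_pmull.
(* This [k] makes the nonterminal pieces of each set fewer than the words of length [n0 * k], so
   that some cylinder remains for the terminal ones. *)
have [k k0 kP] := exists_exp_lt N Nmu.
pose H := gpow G k; pose T := @mpow _ _ _ _ S k.
have [simT KT [d d0 sepT] mass] := system_iter k.
have K0 : (0 < n0 * k)%N by rewrite muln_gt0 n0_gt0.
have rK0 : 0 < r ^+ (n0 * k) by exact: exprn_gt0.
have m0 : (0 < m)%N by exact: ltnW.
pose W : finType := {ffun 'I_(n0 * k) -> 'I_m}.
have w0 : W := [ffun=> Ordinal m0].
pose Ch i := [set e : edge H | (src e == i) && ~~ terminal G (tgt e)]%SET.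
pose Tm i := [set e : edge H | (src e == i) && terminal G (tgt e)]%SET.
have ChW i : (#|Ch i| < #|W|)%N.
  rewrite card_ffun !card_ord expnM -/mu.
  apply: (@leq_ltn_trans (\sum_(e in Ch i) v (tgt e))%N).
    by rewrite -sum1_card leq_sum.
  have := nonterminal_mass i k.
  rewrite (_ : (\sum_(e | _) _)%N = (\sum_(e in Ch i) v (tgt e))%N); last first.
    by apply: eq_bigl => e; rewrite finset.inE.
  move: (\sum_(e in Ch i) _)%N => x xk.
  have : (N ^ k * x < (N * mu) ^ k)%N.
    apply: (leq_ltn_trans xk); apply: leq_ltn_trans kP.
    by rewrite leq_mul2r v_le orbT.
  by rewrite expnMn ltn_pmul2l// expn_gt0 N0.
pose U i := \bigcup_(e in [set` Tm i]) (T e @` K (tgt e)).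
have Tm0 i : Tm i != finset.set0.
  apply/finset.set0Pn; have [|t it tt] := exists_terminal i idG.
    move=> i'; have [t it] : exists e : edge H, src e = i'.
      apply: contrapT => h; have [x Kx] := K_neq0 i'.
      by move: Kx; rewrite KT => -[e ei _]; apply: h; exists e.
    by exists (tgt t); rewrite -(idempotent_pow idG _ _ k0) -it joins_edge.
  move: it; rewrite -(idempotent_pow idG _ _ k0) => /joinsP[e ei et].
  by exists e; rewrite finset.inE ei et eqxx tt.
have bU i : bilip (U i) [set: Sigma].
  apply: (bilip_sigma_bigcup m2 (delta := d) (D := D)) => //.
  - move=> e; rewrite finset.inE => /andP[_ te].
    apply: bilip_trans (bilip_terminal te); apply: bilip_sym.
    by apply: (bilip_scale (a := r ^+ (n0 * k))) => // x y; exact: simT.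
  - move=> e e' /=; rewrite !finset.inE => /andP[/eqP ei _] /andP[/eqP e'i _] ee'.
    exact: (sepT i).
have /choice[code codeP] : forall i, exists f : edge H -> W, {in Ch i &, injective f}.
  by move=> i; apply: exists_code; [exact: w0|exact: ltnW].
(* The terminal pieces and the free cylinders both form nonempty finite unions, hence copies of the
   symbolic space. *)
have /choice[CU CUP] : forall i, exists C, exists rho, acorr C 0 (U i) (free (hr := hr) Ch code i) rho.
  move=> i; have : bilip (U i) (free (hr := hr) Ch code i).
    apply: bilip_trans (bU i) _; apply: bilip_sym.
    have -> : free Ch code i = [set y : Sigma | prefix (n0 * k) y \in (~: (code i @: Ch i))%SET].
      apply/seteqP; split=> y /=; rewrite finset.in_setC.
        by move=> h; apply/imsetP => -[e ei ye]; exact: (h e ei).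
      by move=> /imsetP h e ei ye; apply: h; exists e.
    apply: bilip_prefix => //; rewrite -card_gt0 cardsCs finset.setCK subn_gt0.
    by rewrite card_in_imset//; exact: codeP.
  by move=> [C [rho [_ h]]]; exists C, rho.
(* The recursion requires one constant for all vertices. *)
have [C C0 CUC] := finite_upper_bound CU.
have h := @bilip_recursive R r hr m X 'I_p (edge H) (n0 * k)
  [set i | ~~ terminal G i] K U Ch T (@tgt p H) code D d C.
apply: h => //.
- by move=> i e _; rewrite finset.inE => /andP[].
- move=> i _; rewrite [in LHS]KT; apply/seteqP; split=> [x [e /= ei Fx]|x [[e|] /=]].
  + have [te|te] := boolP (terminal G (tgt e)).
      by exists None => //; exists e => //=; rewrite finset.inE ei eqxx te.
    by exists (Some e) => //=; rewrite /pieces/= finset.inE ei eqxx te.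
  + by rewrite /pieces/= finset.inE => /andP[/eqP ei _] Fx; exists e.
  + by move=> _ [e /=]; rewrite finset.inE => /andP[/eqP ei _] Fx; exists e.
- have UE i x : U i x -> exists e : edge H, [/\ src e = i, terminal G (tgt e) & (T e @` K (tgt e)) x].
    by move=> [e /=]; rewrite finset.inE => /andP[/eqP ei te] Fx; exists e.
  move=> i _ [e|] [e'|] //; rewrite /pieces/= ?finset.inE.
  + move=> /andP[/eqP ei _] /andP[/eqP e'i _] ee' x x' Fx Fx'.
    by apply: (sepT i e e') => // ee; apply: ee'; rewrite ee.
  + move=> /andP[/eqP ei te] _ _ x x' Fx /UE[e' [e'i te' Fx']].
    by apply: (sepT i e e') => // ee; move: te; rewrite ee te'.
  + move=> _ /andP[/eqP ei te] _ x x' /UE[e [e'i te' Fx']] Fx.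
    by apply: (sepT i e e') => // ee; move: te; rewrite -ee te'.
- by move=> i _; have [rho h] := CUP i; exists rho; exact: acorr_weak h.
Qed.

End idempotent_system.
End codings.

(** * From dust-like graph-directed sets to the bilipschitz bijection *)

Lemma system_of_dust_like (R : realType) (r : R) (X : metricType R) (p : nat)
    (G : digraph p) (S : edge G -> X -> X) (K : 'I_p -> set X) (v : 'I_p -> nat) (m : nat) :
  0 < r -> graph_directed_sets r S K -> dust_like S K ->
  (forall i, (\sum_j #|edges G i j| * v j = m * v i)%N) ->
  system K v r m S.
Proof.
move=> r0 [_ simS KP KS] dust mass; split=> //.
- move=> i; rewrite [LHS]KS; apply/seteqP; split=> [x [j _ [e /=]]|x [e /= ei Fx]].
    by rewrite finset.inE => /andP[/eqP ei /eqP ej] Fx; exists e => //; rewrite ej.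
  by exists (tgt e) => //; exists e => //=; rewrite finset.inE ei !eqxx.
(* Distinct pieces of one set are disjoint and compact; the finitely many pairs of edges yield a
   uniform gap, all other pairs receiving the value 1. *)
- have /choice[d dP] : forall x : edge G * edge G, exists d : R, 0 < d /\
      (src x.1 = src x.2 -> x.1 <> x.2 -> forall y y', (S x.1 @` K (tgt x.1)) y ->
       (S x.2 @` K (tgt x.2)) y' -> d <= mdist y y').
    move=> [e e']; have [ee|ee] := pselect (src e = src e' /\ e <> e'); last first.
      by exists 1; split=> //= *; case: ee.
    have cF f : compact (S f @` K (tgt f)).
      by apply: (compact_similarity r0) => //; have [] := KP (tgt f).
    have disj : (S e @` K (tgt e)) `&` (S e' @` K (tgt e')) = set0.
      rewrite -subset0 => x xx; case: ee => ee; apply.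
      by apply: (dust (src e)) => //=; exists x.
    by have [d d0 h] := separated_compact (cF e) (cF e') disj; exists d.
  have [c c0 cd] := @finite_lower_bound R _ d (fun x => (dP x).1).
  exists c => // i e e' /= ei e'i ne x x' Fx Fx'.
  apply: (le_trans (cd (e, e'))).
  by have [_ h] := dP (e, e'); apply: h => //=; rewrite ei.
- move=> i; rewrite -mass (partition_big (fun e => tgt e) xpredT)//=.
  apply: eq_bigr => j _; rewrite (eq_bigr (fun=> v j)) => [|e /andP[_ /eqP->]//].
  rewrite sum_nat_const; congr muln; rewrite -!sum1_card.
  by apply: eq_bigl => e; rewrite /edges finset.inE.
Qed.

Theorem theorem1 (R : realType) (r : R) (hr : 0 < r < 1) (m : nat)
    (hm : (2 <= m)%N) (X : metricType R) (X0 : [set: X] !=set0)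
    (Xcompact : compact [set: X]) (p : nat) (G : digraph p)
    (S : edge G -> X -> X) (K : 'I_p -> set X)
    (HK : graph_directed_sets r S K) (Hdust : dust_like S K)
    (Hchar : integer_characteristic R G m) (i : 'I_p) :
  bilipschitz_equivalent (K i) [set: symbolic hr m].
Proof.
have /andP[r0 _] := hr.
have [_ [u [u0 Au]]] := Hchar.
have [v [v0 mass]] : exists v : 'I_p -> nat, (forall i, 0 < v i)%N /\
    forall i, (\sum_j #|edges G i j| * v j = m * v i)%N.
  apply: (@integral_eigenvector R p (fun i j => #|edges G i j|) m (fun i => u i 0)) => // k.
  have /matrixP/(_ k 0) := Au; rewrite !mxE => <-.
  by apply: eq_bigr => j _; rewrite !mxE.
have sysG := system_of_dust_like r0 HK Hdust mass.
have [D diamX] := compact_diam Xcompact.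
(* Passing to a power of the graph changes neither the sets nor [v]. *)
have [n n0 idG] := exists_idempotent_pow G.
have [_ _ KP _] := HK.
have [C [rho [C0 [rK tK tS d]]]] : bilip (K i) [set: symbolic hr m].
  apply: (bilip_idempotent hm diamX _ _ v0 n0 (system_pow r0 sysG n) idG).
    by move=> j; have [] := KP j.
  by move=> j; have [] := KP j.
(* A default value for [f] outside [K i]. *)
have y0 : symbolic hr m by exact: (fun=> Ordinal (ltnW hm)).
have /choice[f fP] : forall x, exists y, K i x -> rho x y.
  move=> x; have [Kx|nKx] := pselect (K i x); last by exists y0.
  by have [y] := tK _ Kx; exists y.
exists f; split; last first.
  exists C => // x y Kx Ky; have [] := d _ _ _ _ (fP _ Kx) (fP _ Ky).
  by rewrite !addr0 ler_pdivrMl// => -> ->.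
(* Without additive error, distance 0 on one side forces distance 0 on the other. This gives
   injectivity and, by comparing [f x] with [y], surjectivity. *)
split=> // [x y|y _].
  rewrite !inE => Kx Ky fxy; apply: mdist_positivity; apply/eqP.
  rewrite eq_le mdist_ge0 andbT; have [_] := d _ _ _ _ (fP _ Kx) (fP _ Ky).
  by rewrite fxy mdistxx mulr0 addr0.
have [x xy] := tS y I; have [Kx _] := rK _ _ xy; exists x => //.
apply: mdist_positivity; apply/eqP; rewrite eq_le mdist_ge0 andbT.
have [+ _] := d _ _ _ _ (fP _ Kx) xy.
by rewrite mdistxx mulr0 addr0.
Qed.
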